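(* (a) The non-commutative Kondratiev spaces $\widetilde{\mathcal S}_1$ and $\widetilde{\mathcal S}_{-1}$ are both nuclear spaces. (b) For any integers $q\ge p+2$, $$B_{q-p}^2=\sum_{\alpha\in\widetilde\ell}(2\mathbb N)^{-\alpha(q-p)}=\frac{1}{1-2^{-(q-p)}\zeta(q-p)},$$ where $B_{q-p}=\|\Gamma(T_{q,p})\|_{HS}$ and $\zeta$ is Riemann's zeta function. (c) For any integers $q\ge p+2$ and any $f\in\Gamma(\mathcal H_{-p})$, $g\in\Gamma(\mathcal H_{-q})$, $$\|f\otimes g\|_q\le B_{q-p}\|f\|_p\|g\|_q\quad\text{and}\quad\|g\otimes f\|_q\le B_{q-p}\|f\|_p\|g\|_q .$$
   Context: $\mathbb N=\{1,2,\dots\}$. Let $(e_n)_{n\in\mathbb N}$ be an orthonormal basis of $\mathbf L^2(\mathbb R)$. For $p\in\mathbb Z$, $\mathcal H_p$ is the Hilbert space of (formal) sums $\sum_{n\ge1}f_ne_n$, $f_n\in\mathbb C$, with squared norm $\sum_n|f_n|^2(2n)^p<\infty$. For $q\ge p$, $T_{q,p}:\mathcal H_q\hookrightarrow\mathcal H_p$ is the embedding (a contraction). $\Gamma(\mathcal H)=\bigoplus_{n\ge0}\mathcal H^{\otimes n}$ is the full Fock space (Hilbert tensor powers and Hilbert direct sum, $\mathcal H^{\otimes0}=\mathbb C$). For a contraction $T:\mathcal H\to\mathcal H'$, $\Gamma(T):\Gamma(\mathcal H)\to\Gamma(\mathcal H')$ is the bounded operator acting on $\mathcal H^{\otimes n}$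 as $T^{\otimes n}$. $\|\cdot\|_{HS}$ is the Hilbert–Schmidt norm. $\widetilde\ell$ is the free (non-commutative) monoid generated by symbols $z_1,z_2,\dots$, with identity the empty word. For $\alpha=z_{i_1}\cdots z_{i_m}\in\widetilde\ell$ put $e_\alpha=e_{i_1}\otimes\cdots\otimes e_{i_m}$, $(2\mathbb N)^\alpha=\prod_{k=1}^m(2i_k)$ (empty product $=1$) and $(2\mathbb N)^{\alpha s}=((2\mathbb N)^\alpha)^s$. Then $\Gamma(\mathcal H_{-p})$ is identified with the space of $f=\sum_{\alpha\in\widetilde\ell}f_\alpha e_\alpha$ with $\|f\|_p^2:=\sum_\alpha|f_\alpha|^2(2\mathbb N)^{-\alpha p}<\infty$; $\|\cdot\|_p$ denotes the norm of $\Gamma(\mathcal H_{-p})$. $\widetilde{\mathcal S}_1=\bigcap_{p\in\mathbb N}\Gamma(\mathcal H_p)$, topologized as a countably Hilbert (Fréchet) space, and $\widetilde{\mathcal S}_{-1}=\bigcup_{p\in\mathbb N}\Gamma(\mathcal H_{-p})$, topologized as the strong dual of $\widetilde{\mathcal S}_1$. The Wick product is $f\otimes g=\sum_{\gamma\in\widetilde\ell}\big(\sum_{\alpha\beta=\gamma}f_\alpha g_\beta\big)e_\gamma$. *)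

(* Defs.v *)
From HB Require Import structures.
From mathcomp Require Import all_boot all_order all_algebra finmap.
From mathcomp Require Import complex.
From mathcomp Require Import all_classical all_reals all_analysis.
From mathcomp Require Import ring lra.
From mathcomp Require summability.

Set Implicit Arguments.
Unset Strict Implicit.
Unset Printing Implicit Defensive.

Import Order.TTheory GRing.Theory Num.Theory.
Import numFieldTopology.Exports numFieldNormedType.Exports.

Local Open Scope classical_set_scope.
Local Open Scope ring_scope.
Local Open Scope complex_scope.

Definition cabs (R : realType) (z : R[i]) : R := Normc.normc z.

Section cabs_lemmas.
Context {R : realType}.
Implicit Types z t : R[i].

Lemma normcE z : `|z| = (cabs z)%:C. Proof. by []. Qed.

Lemma cabs_ge0 z : 0 <= cabs z.
Proof. by rewrite -lecR; exact: (normr_ge0 (z : R[i])). Qed.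

Lemma cabs0 : cabs (0 : R[i]) = 0. Proof. exact: Normc.normc0. Qed.

Lemma cabsM z t : cabs (z * t) = cabs z * cabs t.
Proof. exact: Normc.normcM. Qed.

Lemma cabsD z t : cabs (z + t) <= cabs z + cabs t.
Proof. exact: le_normcD. Qed.

Lemma cabsN z : cabs (- z) = cabs z.
Proof. exact: normcN. Qed.

End cabs_lemmas.

Section seminorms.
Context {R : realType}.

Definition is_seminorm (E : lmodType R[i]) (p : E -> R) :=
  (forall x y, p (x + y) <= p x + p y) /\
  (forall (a : R[i]) x, p (a *: x) = cabs a * p x).

Record seminorm_family (E : lmodType R[i]) := SeminormFamily {
  sf_index : Type;
  sf_val : sf_index -> E -> R;
  sf_valP : forall i, is_seminorm (sf_val i) }.

(* The space E with the (locally convex) vector topology generated by P: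
   the sets {y | max_(i <- s) P i (y - x) < e} form a basis of
   neighbourhoods of x. *)
Definition lctvs (E : lmodType R[i]) (P : seminorm_family E) : Type := E.

End seminorms.

Section seminorm_topology.
Context {R : realType} (E : lmodType R[i]) (P : seminorm_family E).

HB.instance Definition _ := GRing.Lmodule.copy (lctvs P) E.

Definition sf_max (s : seq (sf_index P)) (x : E) : R :=
  \big[Num.max/0]_(i <- s) sf_val i x.

Definition sf_nbhs (x : lctvs P) : set_system (lctvs P) :=
  [set U | exists s, exists2 e : R, 0 < e &
    [set y : lctvs P | sf_max s (y - x) < e] `<=` U].

Lemma sf_max_ge0 s x : 0 <= sf_max s x.
Proof.
rewrite /sf_max; elim: s => [|i s IH]; first by rewrite big_nil.
by rewrite big_cons le_max IH orbT.
Qed.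

Lemma sf_max_cat s t x : sf_max (s ++ t) x = Num.max (sf_max s x) (sf_max t x).
Proof.
elim: s => [|i s IH].
  by rewrite cat0s /sf_max big_nil; apply/esym/max_idPr; exact: sf_max_ge0.
by rewrite cat_cons /sf_max !big_cons -!/(sf_max _ _) IH maxA.
Qed.

Lemma sf_maxD s x y : sf_max s (x + y) <= sf_max s x + sf_max s y.
Proof.
elim: s => [|i s IH]; first by rewrite /sf_max !big_nil addr0.
rewrite /sf_max !big_cons -!/(sf_max _ _) ge_max; apply/andP; split.
  apply: (le_trans ((sf_valP i).1 x y)).
  by apply: lerD; rewrite le_max lexx.
by apply: (le_trans IH); apply: lerD; rewrite le_max lexx orbT.
Qed.

Lemma sf_maxZ s a x : sf_max s (a *: x) = cabs a * sf_max s x.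
Proof.
elim: s => [|i s IH]; first by rewrite /sf_max !big_nil mulr0.
rewrite /sf_max !big_cons -!/(sf_max _ _) IH (sf_valP i).2.
by rewrite maxr_pMr// cabs_ge0.
Qed.

Lemma sf_maxB s x y z : sf_max s (x - z) <= sf_max s (x - y) + sf_max s (y - z).
Proof. by rewrite -(subrKA y) sf_maxD. Qed.

Lemma sf_max0 s : sf_max s 0 = 0.
Proof. by rewrite -(scale0r 0) sf_maxZ cabs0 mul0r. Qed.

HB.instance Definition _ := hasNbhs.Build (lctvs P) sf_nbhs.

Let sf_nbhs_filter (x : lctvs P) : ProperFilter (nbhs x).
Proof.
split.
  move=> [s [e e0]] /(_ x); rewrite /mkset subrr sf_max0 => /(_ e0).
  exact.
split.
- by exists [::], 1.
- move=> U V [s [e e0 sU]] [t [d d0 tV]].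
  exists (s ++ t), (Num.min e d); first by rewrite lt_min e0.
  move=> y; rewrite /mkset sf_max_cat gt_max !lt_min.
  by move=> /andP[/andP[? _] /andP[_ ?]]; split; [exact: sU|exact: tV].
- by move=> U V UV [s [e e0 sU]]; exists s, e => //; exact: subset_trans UV.
Qed.

Let sf_nbhs_singleton (x : lctvs P) (A : set (lctvs P)) : nbhs x A -> A x.
Proof. by move=> [s [e e0]]; apply; rewrite /mkset subrr sf_max0. Qed.

Lemma sf_ball_nbhs s (x y : lctvs P) (e : R) :
  sf_max s (y - x) < e -> nbhs y [set z : lctvs P | sf_max s (z - x) < e].
Proof.
move=> yx; exists s, (e - sf_max s (y - x)); first by rewrite subr_gt0.
move=> z; rewrite /mkset ltrBrDr => h; exact: le_lt_trans (sf_maxB s z y x) h.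
Qed.

Let sf_nbhs_nbhs (x : lctvs P) (A : set (lctvs P)) :
  nbhs x A -> nbhs x (nbhs^~ A).
Proof.
move=> [s [e e0 sA]]; exists s, e => // y yx.
have [t [d d0 h]] := sf_ball_nbhs yx.
by exists t, d => //; exact: subset_trans sA.
Qed.

HB.instance Definition _ := Nbhs_isNbhsTopological.Build (lctvs P)
  sf_nbhs_filter sf_nbhs_singleton sf_nbhs_nbhs.

Let sf_add_continuous : continuous (fun x : lctvs P * lctvs P => x.1 + x.2).
Proof.
move=> [x y] U [s [e e0 sU]] /=.
exists ([set z : lctvs P | sf_max s (z - x) < e / 2],
        [set z : lctvs P | sf_max s (z - y) < e / 2]).
  by split => /=; exists s, (e / 2); rewrite ?divr_gt0.
move=> [a b] [/= ax by_]; apply: sU => /=.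
rewrite /mkset opprD addrACA (le_lt_trans (sf_maxD _ _ _))//.
by rewrite [e]splitr ltrD.
Qed.

Let sf_scale_continuous :
  continuous (fun z : R[i]^o * lctvs P => z.1 *: z.2).
Proof.
move=> [a x] U [s [e e0 sU]] /=.
pose M := sf_max s x; pose d := e / 2 / (M + 1).
have M0 : 0 <= M by exact: sf_max_ge0.
have d0 : 0 < d by rewrite !divr_gt0// ltr_wpDl.
pose c := e / 2 / (cabs a + d).
have c0 : 0 < c by rewrite !divr_gt0// ltr_wpDl// cabs_ge0.
exists (ball (a : R[i]^o) d%:C,
        [set z : lctvs P | sf_max s (z - x) < c]).
  split => /=; last by exists s, c.
  by apply: nbhsx_ballx; rewrite ltcR.
move=> [b y] [/=]; rewrite -ball_normE /ball_ /= distrC normcE ltcR => ab yx.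
apply: sU => /=; rewrite /mkset.
have -> : b *: y - a *: x = b *: (y - x) + (b - a) *: x.
  by rewrite scalerBr scalerBl addrA subrK.
rewrite (le_lt_trans (sf_maxD _ _ _))// !sf_maxZ [e]splitr ltr_leD//.
  have ba : cabs b < cabs a + d.
    by rewrite -(subrK a b) addrC (le_lt_trans (cabsD _ _))// ltrD2l.
  rewrite (le_lt_trans (_ : _ <= (cabs a + d) * sf_max s (y - x)))//.
    by rewrite ler_wpM2r ?sf_max_ge0// ltW.
  by rewrite mulrC -ltr_pdivlMr// ltr_wpDl// cabs_ge0.
have h1 : cabs (b - a) * sf_max s x <= d * M by rewrite ler_wpM2r// ltW.
apply: (le_trans h1).
have -> : d * M = e / 2 * M / (M + 1) by rewrite /d mulrAC.
by rewrite ler_pdivrMr ?ltr_wpDl// ler_pM2l ?divr_gt0// lerDl.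
Qed.

Let sf_locally_convex :
  exists2 B : set_system (lctvs P), (forall b, b \in B -> convex_set b) & basis B.
Proof.
exists [set b | exists s (x : lctvs P) (e : R), b = [set y : lctvs P | sf_max s (y - x) < e]].
  move=> _ /[!inE] /= -[s [x [e ->]]]; apply/convex_setW => y z.
  rewrite !inE /mkset => yx zx l l0 l1; rewrite inE /mkset.
  set w := (X in X - x).
  have -> : w - x = l%:num *: (y - x) + (1 - l%:num) *: (z - x).
    rewrite !scalerBr addrACA -opprD -scalerDl.
    by rewrite (_ : l%:num + (1 - l%:num) = 1) ?scale1r// addrC subrK.
  rewrite (le_lt_trans (sf_maxD _ _ _))// !sf_maxZ.
  have kE (k : R[i]) : 0 <= k -> k = (cabs k)%:C.
    by move=> k0; rewrite -normcE ger0_norm.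
  have l1' : 0 < 1 - l%:num by rewrite subr_gt0.
  have k1 : cabs l%:num + cabs (1 - l%:num) = 1.
    have h : (cabs l%:num + cabs (1 - l%:num))%:C = 1 :> R[i].
      by rewrite rmorphD /= -!kE// ?(ltW l1')// addrC subrK.
    exact: (congr1 (@complex.Re R) h).
  have kp (k : R[i]) : 0 < k -> 0 < cabs k.
    by move=> k0; rewrite -ltcR -kE ?ltW.
  by rewrite -[e]mul1r -k1 mulrDl ltrD// ltr_pM2l// kp.
split.
  move=> _ [s [x [e ->]]]; rewrite openE => y /= yx; exact: sf_ball_nbhs.
move=> x U [s [e e0 sU]]; exists [set y : lctvs P | sf_max s (y - x) < e] => //.
by split; [exists s, x, e|rewrite /mkset subrr sf_max0].
Qed.

HB.instance Definition _ := PreTopologicalNmodule_isTopologicalNmodule.Build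
  (lctvs P) sf_add_continuous.
HB.instance Definition _ := TopologicalNmodule_isTopologicalLmodule.Build
  R[i] (lctvs P) sf_scale_continuous.
(* The factory PreTopologicalLmod_isTvs only installs the uniform structure. *)
HB.instance Definition _ := PreTopologicalLmod_isTvs.Build R[i] (lctvs P)
  sf_add_continuous sf_scale_continuous sf_locally_convex.
HB.instance Definition _ :=
  Uniform_isTvs.Build R[i] (lctvs P) sf_locally_convex.

End seminorm_topology.

Section nuclear.
Context {R : realType}.

(* Bounded: absorbed by every neighbourhood of 0. *)
Definition tvs_bounded (E : tvsType R[i]) (B : set E) :=
  forall U : set E, nbhs 0 U ->
    exists2 r : R, 0 < r & B `<=` [set r%:C *: x | x in U].

(* The Banach space E_p^, the completion of E / ker p for the norm induced by p,
   consists of the p-Cauchy sequences of E modulo the p-null ones.  The norm of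
   the class of y is lim p (y m), and x in E is sent to the class of the
   constant sequence x. *)
Definition seminorm_cauchy (E : lmodType R[i]) (p : E -> R) (y : nat -> E) :=
  forall e : R, 0 < e -> exists N, forall m n, (N <= m)%N -> (N <= n)%N ->
    p (y m - y n) < e.

Definition completion_norm (E : lmodType R[i]) (p : E -> R) (y : nat -> E) : R :=
  limn (p \o y).

(* The canonical map E -> E_p^ is nuclear: it is x |-> sum_n c_n phi_n(x) y_n,
   with (c_n) absolutely summable, (phi_n) an equicontinuous sequence of linear
   functionals on E, (y_n) a sequence in the unit ball of E_p^ (y n being a
   Cauchy sequence that represents y_n), and the series converging in E_p^. *)
Definition nuclear_canonical_map (E : tvsType R[i]) (p : E -> R) :=
  exists (c : nat -> R[i]) (phi : nat -> {linear E -> R[i]^o})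
         (y : nat -> nat -> E),
  [/\ cvgn (series (fun n => cabs (c n))),
      (exists q : E -> R, [/\ is_seminorm q, continuous q &
         forall n x, cabs (phi n x) <= q x]),
      (forall n, seminorm_cauchy p (y n) /\ completion_norm p (y n) <= 1) &
      forall x : E,
        (fun N => completion_norm p
           (fun m => x - \sum_(n < N) (c n * phi n x) *: y n m)) @ \oo --> 0].

(* Grothendieck's definition, as in Schaefer, Topological Vector Spaces, III.7;
   tvsType means locally convex, and as usual nuclear spaces are Hausdorff. *)
Definition nuclear_space (E : tvsType R[i]) :=
  hausdorff_space E /\
  forall p : E -> R, is_seminorm p -> continuous p -> nuclear_canonical_map p.

End nuclear.

Section weighted_l2.
Context {R : realType} {I : choiceType}.
Implicit Types (w : I -> R) (f g : I -> R[i]).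

(* Norms take values in \bar R, so that they make sense for all f : I -> R[i];
   the weighted l^2 space is the set of those f of finite norm. *)
Definition sqnorm w f : \bar R := \esum_(i in [set: I]) (w i * cabs (f i) ^+ 2)%:E.

Definition norm2 w f : \bar R := (sqnorm w f `^ 2^-1)%E.

Definition l2_pred w : {pred I -> R[i]} := [pred f | (norm2 w f < +oo)%E].

End weighted_l2.

Section weighted_l2_theory.
Context {R : realType} {I : choiceType} (w : I -> R) (w_ge0 : forall i, 0 <= w i).
Implicit Types f g : I -> R[i].
Local Open Scope ereal_scope.

Lemma esumZl_le (c : R) (a : I -> \bar R) : (0 <= c)%R -> (forall i, 0 <= a i) ->
  \esum_(i in [set: I]) (c%:E * a i) <= c%:E * \esum_(i in [set: I]) a i.
Proof.
move=> c0 a0; apply: ge_ereal_sup => _ [A [finA _] <-].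
rewrite -ge0_mule_fsumr// lee_wpmul2l ?lee_fin//.
by apply: esum_ge; exists A.
Qed.

Lemma sqnorm_ge0 f : 0 <= sqnorm w f.
Proof. by apply: esum_ge0 => i _; rewrite lee_fin mulr_ge0 ?sqr_ge0. Qed.

Lemma norm2_ge0 f : 0 <= norm2 w f. Proof. exact: poweR_ge0. Qed.

Lemma norm2K f : norm2 w f ^+ 2 = sqnorm w f.
Proof.
have := sqnorm_ge0 f; rewrite /norm2; case: (sqnorm w f) => [r||] //.
  rewrite lee_fin => r0; rewrite poweR_EFin powR12_sqrt// -EFin_expe.
  by rewrite sqr_sqrtr.
by move=> _; rewrite poweRyr ?expe2 ?mulyy// gt_eqF// invr_gt0.
Qed.

Lemma sqnormD_le f g (t : R) : (0 < t)%R ->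
  sqnorm w (f + g)%R <= (1 + t)%:E * sqnorm w f + (1 + t^-1)%:E * sqnorm w g.
Proof.
move=> t0; have ti0 : (0 < t^-1)%R by rewrite invr_gt0.
have pos h i : 0 <= (w i * cabs (h i) ^+ 2)%:E.
  by rewrite lee_fin mulr_ge0 ?sqr_ge0.
apply: (@le_trans _ _ (\esum_(i in [set: I]) ((1 + t)%:E * (w i * cabs (f i) ^+ 2)%:E
    + (1 + t^-1)%:E * (w i * cabs (g i) ^+ 2)%:E))).
  apply: le_esum => i _; rewrite -!EFinM -EFinD lee_fin.
  set x := cabs (f i); set y := cabs (g i).
  rewrite (_ : (1 + t) * (w i * x ^+ 2) + (1 + t^-1) * (w i * y ^+ 2) =
    w i * ((1 + t) * x ^+ 2 + (1 + t^-1) * y ^+ 2))%R; last by ring.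
  rewrite ler_wpM2l//.
  apply: (@le_trans _ _ ((x + y) ^+ 2)%R).
    by rewrite ler_sqr ?nnegrE ?addr_ge0 ?cabs_ge0// cabsD.
  rewrite -subr_ge0 (_ : _ - _ = t^-1 * (t * x - y) ^+ 2)%R; last first.
    by field; rewrite gt_eqF.
  by rewrite mulr_ge0 ?sqr_ge0// ltW.
rewrite esumD//; try by move=> i _; rewrite mule_ge0// lee_fin addr_ge0// ltW.
by apply: leeD; apply: esumZl_le => //; rewrite addr_ge0// ltW.
Qed.

Lemma l2_finE f : f \in l2_pred w -> norm2 w f = (fine (norm2 w f))%:E.
Proof. by move=> fw; rewrite fineK// ge0_fin_numE ?norm2_ge0. Qed.

Lemma norm2D f g : norm2 w (f + g)%R <= norm2 w f + norm2 w g.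
Proof.
have [fw|] := boolP (f \in l2_pred w); last first.
  rewrite inE -leNgt leye_eq => /eqP ->; rewrite addye ?leey//.
  by rewrite gt_eqF// (lt_le_trans _ (norm2_ge0 g)).
have [gw|] := boolP (g \in l2_pred w); last first.
  rewrite inE -leNgt leye_eq => /eqP ->; rewrite addey ?leey//.
  by rewrite gt_eqF// (lt_le_trans _ (norm2_ge0 f)).
rewrite (l2_finE fw) (l2_finE gw).
set A := fine _; set B := fine _.
have A0 : (0 <= A)%R by rewrite fine_ge0 ?norm2_ge0.
have B0 : (0 <= B)%R by rewrite fine_ge0 ?norm2_ge0.
apply/lee_addgt0Pr => e e0; rewrite -!EFinD.
have [d d0 ->] : exists2 d : R, (0 < d)%R & e = (d + d)%R.
  by exists (e / 2)%R; rewrite ?divr_gt0// -splitr.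
have Ad0 : (0 < A + d)%R by rewrite ltr_wpDl.
have Bd0 : (0 < B + d)%R by rewrite ltr_wpDl.
have ABd : (0 <= A + B + (d + d))%R by rewrite !addr_ge0// ltW.
have t0 : (0 < (B + d) / (A + d))%R by rewrite divr_gt0.
have := sqnormD_le f g t0.
rewrite -!norm2K (l2_finE fw) (l2_finE gw) -/A -/B -!EFin_expe -!EFinM -EFinD.
have h : ((1 + (B + d) / (A + d)) * A ^+ 2 + (1 + ((B + d) / (A + d))^-1) * B ^+ 2
    <= (A + B + (d + d)) ^+ 2)%R.
  have -> : ((A + B + (d + d)) ^+ 2 = (1 + (B + d) / (A + d)) * (A + d) ^+ 2
      + (1 + ((B + d) / (A + d))^-1) * (B + d) ^+ 2)%R.
    by field; rewrite !gt_eqF.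
  by rewrite lerD// ler_wpM2l ?addr_ge0 ?invr_ge0 ?(ltW t0)// ler_sqr ?nnegrE
     ?(ltW Ad0) ?(ltW Bd0)// lerDl ltW.
have := norm2_ge0 (f + g)%R; case: (norm2 w (f + g)%R) => [r||]// r0.
rewrite -EFin_expe !lee_fin => /le_trans /(_ h).
by rewrite ler_sqr.
Qed.

Lemma norm2Z_le (a : R[i]) f : norm2 w (a *: f)%R <= (cabs a)%:E * norm2 w f.
Proof.
suff : norm2 w (a *: f)%R ^+ 2 <= ((cabs a)%:E * norm2 w f) ^+ 2.
  by rewrite lee_sqr ?mule_ge0 ?norm2_ge0 ?lee_fin ?cabs_ge0.
rewrite expe2 [in leRHS]expe2 muleACA -!expe2 !norm2K -EFin_expe.
apply: le_trans (esumZl_le _ _); last 2 first.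
- by rewrite exprn_ge0// cabs_ge0.
- by move=> i; rewrite lee_fin mulr_ge0 ?sqr_ge0.
apply: le_esum => i _.
by rewrite -EFinM lee_fin (_ : (a *: f) i = (a * f i)%R)// cabsM exprMn mulrCA.
Qed.

End weighted_l2_theory.

Record weight (R : realType) (I : choiceType) := Weight {
  weight_val :> I -> R;
  weight_gt0 : forall i, 0 < weight_val i }.

Section l2_space.
Context {R : realType} {I : choiceType}.

Record l2 (w : weight R I) := L2 {
  l2_val :> I -> R[i];
  l2_valP : l2_val \in l2_pred w }.

HB.instance Definition _ (w : weight R I) := [isSub for @l2_val w].
HB.instance Definition _ (w : weight R I) := [Choice of l2 w by <:].

Lemma l2_submod_closed (w : weight R I) : submod_closed (l2_pred w).
Proof.
have w0 i : 0 <= w i by exact/ltW/weight_gt0.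
split.
  have := norm2Z_le w0 (0 : R[i]) (0 : I -> R[i]).
  by rewrite cabs0 mul0e scale0r inE => /le_lt_trans; apply; rewrite ltry.
move=> a f g; rewrite !inE => fw gw.
apply: (le_lt_trans (norm2D w0 _ _)); rewrite lte_add_pinfty//.
apply: (le_lt_trans (norm2Z_le w0 _ _)).
by rewrite lte_mul_pinfty// lee_fin cabs_ge0.
Qed.

HB.instance Definition _ (w : weight R I) := GRing.isSubmodClosed.Build R[i] (I -> R[i])
  (l2_pred w) (l2_submod_closed w).
HB.instance Definition _ (w : weight R I) := [SubChoice_isSubLmodule of l2 w by <:].

Lemma fine_norm2_seminorm (w : weight R I) (E : lmodType R[i])
    (h : {linear E -> I -> R[i]}) :
  (forall x, h x \in l2_pred w) -> is_seminorm (fun x => fine (norm2 w (h x))).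
Proof.
move=> hw; have w0 i : 0 <= w i by exact/ltW/weight_gt0.
have le a x : fine (norm2 w (h (a *: x))) <= cabs a * fine (norm2 w (h x)).
  rewrite -lee_fin EFinM -!l2_finE// linearZ; exact: norm2Z_le.
split=> [x y|a x].
  by rewrite -lee_fin EFinD -!l2_finE// linearD norm2D.
apply/eqP; rewrite eq_le le /=.
have [->|a0] := eqVneq a 0.
  by rewrite cabs0 mul0r fine_ge0// norm2_ge0.
have ca0 : 0 < cabs a.
  rewrite lt_neqAle cabs_ge0 andbT eq_sym; apply/eqP => /Normc.eq0_normc.
  exact/eqP.
rewrite -ler_pdivlMl//; have := le a^-1 (a *: x).
rewrite scalerA mulVf// scale1r.
suff -> : cabs a^-1 = (cabs a)^-1 by [].
exact: Normc.normcV.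
Qed.

End l2_space.

#[export] Existing Instance summability.totally_filter.

Section complex_sums.
Context {R : realType} {I : choiceType}.
Implicit Types f g : I -> R[i].

(* The sum of an (absolutely summable) complex family, as the limit of its
   finite partial sums. *)
Definition csum f : R[i] := summability.sum (f : I -> R[i]^o).

Definition abs_summable f := (\esum_(i in [set: I]) (cabs (f i))%:E < +oo)%E.

Let ps (f : I -> R[i]) : {fset I} -> R[i]^o :=
  summability.partial_sum (f : I -> R[i]^o).

Lemma real_sum_cvg (a : I -> R) : (forall i, 0 <= a i) ->
  (\esum_(i in [set: I]) (a i)%:E < +oo)%E ->
  ps (fun i => (a i)%:C) @ summability.totally --> 
    ((fine (\esum_(i in [set: I]) (a i)%:E))%:C : R[i]^o).
Proof.
move=> a0 afin.
set S := \esum_(i in _) _ in afin *.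
have S0 : (0 <= S)%E by apply: esum_ge0 => i _; rewrite lee_fin.
have Sf : S \is a fin_num by rewrite ge0_fin_numE.
have psE (A : {fset I}) :
    (\sum_(i \in [set` A]) (a i)%:E)%E = (\sum_(i <- A) a i)%:E.
  rewrite fsbig_finite//= set_fsetK sumEFin//.
have psC (A : {fset I}) : ps (fun i => (a i)%:C) A = (\sum_(i <- A) a i)%:C.
  by rewrite /ps /summability.partial_sum rmorph_sum /= [RHS]big_seq_fsetE.
apply/cvgrPdist_lt => e e0.
have eE : e = (complex.Re e)%:C.
  by case: e e0 => x y /andP[/eqP /= -> _].
rewrite eE; have {}e0 : 0 < complex.Re e by rewrite -ltcR -eE.
set d := complex.Re e in e0 *.
have /ereal_sup_gt[_ [A [finA _] <-] SA] : (S - d%:E < S)%E.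
  by rewrite -(fineK Sf) -EFinB lte_fin ltrBlDr ltrDl.
exists (fset_set A) => // J /= AJ; rewrite psC /ball_ -rmorphB normcE ltcR.
have JS : (\sum_(i <- J) a i <= fine S).
  rewrite -lee_fin -psE fineK//; apply: esum_ge; exists [set` J] => //.
have AS : (fine S - d < \sum_(i <- J) a i).
  rewrite -lte_fin EFinB fineK// (lt_le_trans SA)// -psE.
  apply: lee_fsum_nneg_subset => //.
  - move=> i; rewrite !inE => iA; move/fsubsetP: AJ; apply.
    by rewrite in_fset_set// inE.
  - by move=> i _; rewrite lee_fin.
rewrite /cabs /= expr0n /= addr0 sqrtr_sqr ger0_norm ?subr_ge0//.
by rewrite ltrBlDr addrC -ltrBlDr.
Qed.

Let psD f g : ps (f + g) = ps f + ps g.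
Proof.
by apply/funext => A; rewrite /ps /summability.partial_sum fctE big_split.
Qed.

Let psZ (a : R[i]) f : ps (a *: f) = a \*: ps f.
Proof.
apply/funext => A; rewrite /ps /summability.partial_sum /= scaler_sumr.
exact: eq_bigr.
Qed.

Lemma le_Re_cabs (z : R[i]) : `|complex.Re z| <= cabs z.
Proof.
case: z => x y /=; rewrite -sqrtr_sqr; apply: ler_wsqrtr.
by rewrite lerDl sqr_ge0.
Qed.

Lemma le_Im_cabs (z : R[i]) : `|complex.Im z| <= cabs z.
Proof.
case: z => x y /=; rewrite -sqrtr_sqr; apply: ler_wsqrtr.
by rewrite lerDr sqr_ge0.
Qed.

Let pos_cvg f (h : R[i] -> R) : abs_summable f ->
  (forall z, `|h z| <= cabs z) ->
  cvg (ps (fun i => (Num.max (h (f i)) 0)%:C) @ summability.totally).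
Proof.
move=> fs hle; apply/cvg_ex; eexists; apply: real_sum_cvg.
  by move=> i; rewrite le_max lexx orbT.
apply: le_lt_trans fs; apply: le_esum => i _; rewrite lee_fin ge_max cabs_ge0.
by rewrite andbT (le_trans (ler_norm _)).
Qed.

Lemma csum_cvg f : abs_summable f ->
  ps f @ summability.totally --> (csum f : R[i]^o).
Proof.
move=> fs.
suff : cvg (ps f @ summability.totally) by [].
pose part (h : R[i] -> R) : I -> R[i] := fun i => (Num.max (h (f i)) 0)%:C.
have -> : f = part (@complex.Re R) + (-1) *: part (fun z => - complex.Re z)
   + 'i *: (part (@complex.Im R) + (-1) *: part (fun z => - complex.Im z)).
  apply/funext => i; rewrite /part !fctE.
  have mx (x : R) : (Num.max x 0)%:C + -1 *: (Num.max (- x) 0)%:C = x%:C :> R[i].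
    rewrite scaleN1r -rmorphB /=; congr (_%:C).
    have [x0|x0] := leP 0 x.
      by rewrite max_r ?oppr_le0// subr0.
    by rewrite max_l ?oppr_ge0 1?ltW// sub0r opprK.
  transitivity ((complex.Re (f i))%:C + 'i *: (complex.Im (f i))%:C).
    by case: (f i) => x y; rewrite /GRing.scale /=; simpc.
  by rewrite -(mx (complex.Re (f i))) -(mx (complex.Im (f i))).
have cv h : (forall z, `|h z| <= cabs z) -> cvg (ps (part h) @ summability.totally).
  by move=> hle; exact: pos_cvg.
rewrite !psD !psZ !psD !psZ.
apply: is_cvgD; [apply: is_cvgD|apply: is_cvgZr; apply: is_cvgD].
- by apply: cv => z; exact: le_Re_cabs.
- by apply: is_cvgZr; apply: cv => z; rewrite normrN; exact: le_Re_cabs.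
- by apply: cv => z; exact: le_Im_cabs.
- by apply: is_cvgZr; apply: cv => z; rewrite normrN; exact: le_Im_cabs.
Qed.

Lemma csumD f g : abs_summable f -> abs_summable g ->
  csum (f + g) = csum f + csum g.
Proof.
move=> fs gs; apply: (@cvg_lim R[i]^o) => //.
rewrite -[X in X @ _]/(ps (f + g)) psD.
by apply: cvgD; exact: csum_cvg.
Qed.

Lemma csumZ (a : R[i]) f : abs_summable f -> csum (a *: f) = a * csum f.
Proof.
move=> fs; apply: (@cvg_lim R[i]^o) => //.
rewrite -[X in X @ _]/(ps (a *: f)) psZ.
by apply: cvgZr; exact: csum_cvg.
Qed.

Lemma cabs_csum f : abs_summable f ->
  ((cabs (csum f))%:E <= \esum_(i in [set: I]) (cabs (f i))%:E)%E.
Proof.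
move=> fs; set S := \esum_(i in _) _.
have S0 : (0 <= S)%E by apply: esum_ge0 => i _; rewrite lee_fin cabs_ge0.
have SE : S = (fine S)%:E by rewrite fineK// ge0_fin_numE.
rewrite SE lee_fin; apply/ler_addgt0Pr => e e0.
have /cvgrPdist_lt/(_ e%:C) := csum_cvg fs.
rewrite ltcR => /(_ e0)[A _ /(_ A)]; rewrite /mkset fsubset_refl => /(_ isT).
rewrite normcE ltcR => lA.
have psA : cabs (ps f A) <= fine S.
  rewrite -lee_fin -SE; apply: esum_ge; exists [set` A] => //.
  rewrite fsbig_finite//= set_fsetK sumEFin lee_fin.
  rewrite -lecR -normcE (le_trans (ler_norm_sum _ _ _))// big_seq_fsetE /=.
  by rewrite rmorph_sum.
rewrite -(subrK (ps f A) (csum f)) (le_trans (cabsD _ _))// addrC lerD//.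
exact: ltW.
Qed.

End complex_sums.

Section hilbert_schmidt.
Context {R : realType}.

Definition l2_dot (I : choiceType) (w : weight R I) (f g : I -> R[i]) : R[i] :=
  csum (fun i => (w i)%:C * f i * (g i)^*).

(* Orthonormal, with dense linear span. *)
Definition orthonormal_basis (I J : choiceType) (w : weight R I)
    (u : J -> l2 w) :=
  (forall j k, l2_dot w (u j) (u k) = (j == k)%:R) /\
  (forall (f : l2 w) (e : R), 0 < e ->
    exists (s : seq J) (c : J -> R[i]),
      (norm2 w (f - \sum_(j <- s) c j *: u j)%R < e%:E)%E).

(* The square root of sum_i |A u_i|^2 for an orthonormal basis u of l2 w (the
   value does not depend on u).  I can serve as its index set, since the vectors
   delta_i / sqrt (w i) form an orthonormal basis. *)
Definition HS_norm (I I' : choiceType) (w : weight R I) (w' : weight R I')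
    (A : l2 w -> l2 w') : \bar R :=
  let u : I -> l2 w := xget (fun=> 0) [set u | orthonormal_basis u] in
  ((\esum_(i in [set: I]) norm2 w' (A (u i)) ^+ 2) `^ 2^-1)%E.

End hilbert_schmidt.

(* The free monoid on z_1, z_2, ... is seq nat, with k : nat standing for the
   letter z_(k+1); likewise the k-th coordinate of an element of H_p is its
   coefficient on e_(k+1).  twoN al is (2N)^al. *)
Definition twoN (al : seq nat) : nat := (\prod_(i <- al) (2 * i.+1))%N.

Lemma twoN_gt0 al : (0 < twoN al)%N.
Proof. by rewrite /twoN big_seq; apply: prodn_cond_gt0. Qed.

Section fock_spaces.
Context (R : realType).

Fact letter_weight_gt0 (p : int) (n : nat) : 0 < ((2 * n.+1)%N%:R : R) ^ p.
Proof. by rewrite exprz_gt0// ltr0n. Qed.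

Definition letter_weight (p : int) : weight R nat :=
  Weight (letter_weight_gt0 p).

Fact word_weight_gt0 (p : int) (al : seq nat) : 0 < ((twoN al)%:R : R) ^ p.
Proof. by rewrite exprz_gt0// ltr0n twoN_gt0. Qed.

Definition word_weight (p : int) : weight R (seq nat) :=
  Weight (word_weight_gt0 p).

(* H_p and Gamma(H_p), in the coordinates (e_n) and (e_al). *)
Definition Hsp (p : int) := l2 (letter_weight p).

Definition fock (p : int) := l2 (word_weight p).

(* Used for p <= q, in which case x belongs to H_p and T_emb q p x has the same
   coordinates as x. *)
Definition T_emb (q p : int) (x : Hsp q) : Hsp p := insubd 0 (x : nat -> R[i]).

(* The coordinates of x_1 (x) ... (x) x_m. *)
Definition tensor (xs : seq (nat -> R[i])) : seq nat -> R[i] := fun al =>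
  if size al == size xs
  then \prod_(k < size xs) nth 0 xs k (nth 0%N al k) else 0.

(* A is the second quantization of T: the bounded linear operator such that
   A (x_1 (x) ... (x) x_m) = T x_1 (x) ... (x) T x_m for all m and x_1, ..., x_m.
   It is unique, since these tensors span a dense subspace. *)
Definition is_fock_map (q p : int) (T : Hsp q -> Hsp p)
    (A : fock q -> fock p) :=
  [/\ linear A,
      (exists M : R, forall f,
        (norm2 (word_weight p) (A f) <= M%:E * norm2 (word_weight q) f)%E) &
      forall (xs : seq (Hsp q)) (F : fock q),
        F = tensor [seq l2_val x | x <- xs] :> (seq nat -> R[i]) ->
        A F = tensor [seq l2_val (T x) | x <- xs] :> (seq nat -> R[i])].

Definition fock_map (q p : int) (T : Hsp q -> Hsp p) : fock q -> fock p :=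
  xget (fun=> 0) [set A | is_fock_map T A].

(* B_(q-p) *)
Definition Bconst (q p : int) : \bar R := HS_norm (fock_map (@T_emb q p)).

(* The norm of Gamma(H_(-p)): mind the sign. *)
Definition fock_norm (p : int) (f : seq nat -> R[i]) : \bar R :=
  norm2 (word_weight (- p)) f.

(* The factorizations ga = al be are the pairs (take k ga, drop k ga). *)
Definition wick (f g : seq nat -> R[i]) : seq nat -> R[i] := fun ga =>
  \sum_(k < (size ga).+1) f (take k ga) * g (drop k ga).

(* Riemann's zeta function on the real half-line s > 1. *)
Definition zeta (s : R) : R := limn (series (fun n => n.+1%:R `^ (- s))).

End fock_spaces.

Section kondratiev_spaces.
Context (R : realType).
Local Notation fct := (seq nat -> R[i]).

Definition S1_pred : {pred fct} := fun f =>
  `[< forall p : nat, (0 < p)%N -> f \in l2_pred (word_weight R p) >].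

Definition Sm1_pred : {pred fct} := fun f =>
  `[< exists2 p : nat, (0 < p)%N & f \in l2_pred (word_weight R (- p%:Z)) >].

Lemma S1_submod_closed : submod_closed S1_pred.
Proof.
split; first by apply/asboolP => p _; exact: rpred0.
move=> a f g /asboolP fS /asboolP gS; apply/asboolP => p p0.
by rewrite rpredD ?rpredZ ?fS ?gS.
Qed.

Lemma l2_word_weight_le (p q : int) (f : fct) : p <= q ->
  f \in l2_pred (word_weight R q) -> f \in l2_pred (word_weight R p).
Proof.
move=> pq; rewrite !inE; apply: le_lt_trans.
have sq0 (r : int) : (0 <= sqnorm (word_weight R r) f)%E.
  by apply: sqnorm_ge0 => i; exact/ltW/weight_gt0.
apply: gt0_ler_poweR; rewrite ?invr_ge0 ?in_itv/= ?leey ?andbT; try exact: sq0.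
  by [].
apply: le_esum => al _; rewrite lee_fin ler_wpM2r ?sqr_ge0//.
by rewrite /= ler_weXz2l// ler1n twoN_gt0.
Qed.

Lemma Sm1_submod_closed : submod_closed Sm1_pred.
Proof.
split; first by apply/asboolP; exists 1%N => //; exact: rpred0.
move=> a f g /asboolP[p p0 fS] /asboolP[q q0 gS].
apply/asboolP; exists (p + q)%N; first by rewrite addn_gt0 p0.
rewrite rpredD ?rpredZ//.
  by apply: l2_word_weight_le fS; rewrite lerN2 lez_nat leq_addr.
by apply: l2_word_weight_le gS; rewrite lerN2 lez_nat leq_addl.
Qed.

HB.instance Definition _ := GRing.isSubmodClosed.Build R[i] fct S1_pred
  S1_submod_closed.
HB.instance Definition _ := GRing.isSubmodClosed.Build R[i] fct Sm1_pred
  Sm1_submod_closed.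

Record S1_space := S1Space { S1_val :> fct; S1_valP : S1_val \in S1_pred }.
HB.instance Definition _ := [isSub for S1_val].
HB.instance Definition _ := [Choice of S1_space by <:].
HB.instance Definition _ := [SubChoice_isSubLmodule of S1_space by <:].

Record Sm1_space := Sm1Space { Sm1_val :> fct; Sm1_valP : Sm1_val \in Sm1_pred }.
HB.instance Definition _ := [isSub for Sm1_val].
HB.instance Definition _ := [Choice of Sm1_space by <:].
HB.instance Definition _ := [SubChoice_isSubLmodule of Sm1_space by <:].

Definition S1_norm (p : {p : nat | (0 < p)%N}) (f : S1_space) : R :=
  fine (norm2 (word_weight R (sval p)) f).

Fact S1_norm_seminorm p : is_seminorm (S1_norm p).
Proof.
apply: (@fine_norm2_seminorm _ _ _ S1_space \val) => f.
by have /asboolP := S1_valP f; apply; exact: (svalP p).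
Qed.

Definition S1_norms : seminorm_family S1_space :=
  SeminormFamily S1_norm_seminorm.

(* The intersection of the Gamma(H_p), p = 1, 2, ..., with its countably Hilbert
   topology. *)
Definition S1 : tvsType R[i] := lctvs S1_norms.

(* The duality between the union of the Gamma(H_(-p)) and S1.  The sesquilinear
   pairing would give the same topology, the bounded subsets of S1 being stable
   under conjugation. *)
Definition pairing (f : Sm1_space) (x : S1_space) : R[i] :=
  csum (fun al => f al * x al).

Lemma pairing_bound (f : Sm1_space) : exists p : {p : nat | (0 < p)%N},
  exists C : R, forall x : S1_space,
    (\esum_(al in [set: seq nat]) (cabs (f al * x al))%:E
       <= (C + S1_norm p x ^+ 2)%:E)%E.
Proof.
have /asboolP[p p0 fp] := Sm1_valP f.
exists (exist _ p p0), (fine (norm2 (word_weight R (- p%:Z)) f) ^+ 2) => x.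
have xp : S1_val x \in l2_pred (word_weight R p).
  by have /asboolP := S1_valP x; apply.
have wge0 (r : int) i : 0 <= word_weight R r i by exact/ltW/weight_gt0.
rewrite EFinD !EFin_expe /S1_norm -(l2_finE fp) -(l2_finE xp).
rewrite !norm2K// -esumD; try by
  move=> i _; rewrite lee_fin mulr_ge0 ?sqr_ge0.
apply: le_esum => al _; rewrite -EFinD lee_fin cabsM.
set a := cabs _; set b := cabs _.
have a0 : 0 <= a by exact: cabs_ge0.
have b0 : 0 <= b by exact: cabs_ge0.
rewrite /= -invr_expz; set v := (twoN al)%:R ^ p%:Z.
have v0 : 0 < v by exact: (word_weight_gt0 R p%:Z al).
have : 0 <= v^-1 * (a - v * b) ^+ 2 by rewrite mulr_ge0 ?sqr_ge0 ?invr_ge0 ?ltW.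
have -> : v^-1 * (a - v * b) ^+ 2 = v^-1 * a ^+ 2 + v * b ^+ 2 - 2 * (a * b).
  by field; rewrite gt_eqF.
have ab0 : 0 <= a * b by rewrite mulr_ge0.
lra.
Qed.

Lemma pairing_summable (f : Sm1_space) (x : S1_space) :
  abs_summable (fun al => f al * x al).
Proof.
have [p [C le]] := pairing_bound f.
by apply: (le_lt_trans (le x)); rewrite ltry.
Qed.

Definition dual_seminorm (B : {B : set S1 | tvs_bounded B}) (f : Sm1_space) : R :=
  sup [set cabs (pairing f x) | x in sval B].

Lemma S1_norm_bounded (B : set S1) p : tvs_bounded B ->
  exists M : R, forall x, B x -> S1_norm p x <= M.
Proof.
have U0 : nbhs (0 : S1) [set x : S1 | S1_norm p x < 1].
  exists [:: p], 1 => // x; rewrite /mkset subr0 /sf_max big_cons big_nil => h.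
  by apply: le_lt_trans h; rewrite le_max lexx.
move=> /(_ _ U0) [r r0 BU]; exists r => x /BU [y /= y1 <-].
rewrite (S1_norm_seminorm p).2 /cabs /= expr0n /= addr0 sqrtr_sqr gtr0_norm//.
by rewrite ler_piMr ?ltW.
Qed.

Lemma dual_has_ubound (B : {B : set S1 | tvs_bounded B}) (f : Sm1_space) :
  has_ubound [set cabs (pairing f x) | x in sval B].
Proof.
have [p [C le]] := pairing_bound f.
have [M BM] := S1_norm_bounded p (svalP B).
exists (C + M ^+ 2) => _ [x Bx <-]; rewrite -lee_fin.
apply: (le_trans (cabs_csum (pairing_summable f x))).
apply: (le_trans (le x)); rewrite lee_fin lerD2l ler_sqr ?nnegrE ?BM//.
  by rewrite fine_ge0// norm2_ge0.
by rewrite (le_trans _ (BM _ Bx))// fine_ge0// norm2_ge0.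
Qed.

Lemma pairingD f g x : pairing (f + g) x = pairing f x + pairing g x.
Proof.
rewrite /pairing -csumD; try exact: pairing_summable.
by congr csum; apply/funext => al; rewrite /= mulrDl.
Qed.

Lemma pairingZ a f x : pairing (a *: f) x = a * pairing f x.
Proof.
rewrite /pairing -csumZ; try exact: pairing_summable.
by congr csum; apply/funext => al; rewrite /= -mulrA.
Qed.

Fact dual_seminormP B : is_seminorm (dual_seminorm B).
Proof.
have [B0|/set0P [x0 Bx0]] := eqVneq (sval B) set0.
  have d0 f : dual_seminorm B f = 0.
    by rewrite /dual_seminorm B0 image_set0 sup0.
  by split => *; rewrite !d0 ?addr0 ?mulr0.
have ub f x : sval B x -> cabs (pairing f x) <= dual_seminorm B f.
  by move=> Bx; apply: ub_le_sup; [exact: dual_has_ubound|exists x].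
have lub f M : (forall x, sval B x -> cabs (pairing f x) <= M) ->
    dual_seminorm B f <= M.
  move=> h; apply: ge_sup; first by exists (cabs (pairing f x0)), x0.
  by move=> _ [x Bx <-]; exact: h.
have leZ a f : dual_seminorm B (a *: f) <= cabs a * dual_seminorm B f.
  by apply: lub => x Bx; rewrite pairingZ cabsM ler_wpM2l ?cabs_ge0 ?ub.
split=> [f g|a f].
  apply: lub => x Bx; rewrite pairingD (le_trans (cabsD _ _))//.
  by rewrite lerD ?ub.
apply/eqP; rewrite eq_le leZ /=.
have [->|a0] := eqVneq a 0.
  by rewrite cabs0 mul0r (le_trans _ (ub _ _ Bx0))// cabs_ge0.
have ca0 : 0 < cabs a.
  rewrite lt_neqAle cabs_ge0 andbT eq_sym; apply/eqP => /Normc.eq0_normc.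
  exact/eqP.
rewrite -ler_pdivlMl//; have := leZ a^-1 (a *: f).
rewrite scalerA mulVf// scale1r.
suff -> : cabs a^-1 = (cabs a)^-1 by [].
exact: Normc.normcV.
Qed.

Definition dual_seminorms : seminorm_family Sm1_space :=
  SeminormFamily dual_seminormP.

(* The union of the Gamma(H_(-p)), p = 1, 2, ..., as the strong dual of S1: the
   topology of uniform convergence on the bounded subsets of S1. *)
Definition Sm1 : tvsType R[i] := lctvs dual_seminorms.

End kondratiev_spaces.

(* Main.v *)
Require Import Defs.
From HB Require Import structures.
From mathcomp Require Import all_boot all_order all_algebra finmap.
From mathcomp Require Import complex.
From mathcomp Require Import all_classical all_reals all_analysis.
From mathcomp Require Import ring lra.
From mathcomp Require summability.

(** Everything rests on one numerical fact: for an integer s >= 2 the family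
    (2N)^(-al s), indexed by the words al, is summable.  As (2N)^al is the product
    of the weights of the letters of al, the words of length n contribute T^n,
    where T = 2^(-s) zeta(s) is the sum over single letters, and T <= 1/2 because
    zeta(2) <= 2.  Summing the geometric series gives the closed formula
    ([twoN_sum]).

    The operator Gamma(T_(q,p)) leaves coordinates unchanged ([fock_mapE]): it does
    so on the tensors of basis vectors, and these span a dense subspace.  For an
    orthonormal basis u of Gamma(H_q) its squared Hilbert-Schmidt norm is the
    double sum over j and al of w_p(al) |u_j(al)|^2.  Parseval's identity
    ([parseval]), applied to the basis vector e_al, gives
    sum_j |u_j(al)|^2 = 1 / w_q(al), so that the double sum is the word sum for
    s = q - p ([Bconst_sqr]).

    For the Wick product put F(al) = |f_al| (2N)^(-al q / 2) and
    G(al) = |g_al| (2N)^(-al q / 2).  Since (2N)^al is multiplicative in al,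
    f (x) g is dominated by the convolution of F and G, and this is Young's
    inequality l^1 * l^2 -> l^2; by Cauchy-Schwarz
    sum F <= B_(q-p) ||f||_p ([conv_sqnorm_le]).

    Both Kondratiev spaces are nuclear for the same reason
    ([coordinates_nuclear]).  Suppose that a continuous seminorm p satisfies
    p(x) <= sum_al a_al |x_al| with a_al |x_al| <= d_al q(x) for a continuous
    seminorm q and a summable family d.  Then the expansion
    x = sum_al d_al (d_al^-1 a_al x_al) (a_al^-1 e_al) exhibits the canonical map as
    nuclear: the functionals are bounded by q, and the vectors have p-norm at most
    one.  Here d = (2N)^(-2 al).  On S_1, a power (2N)^(k al) serves as a_al, and q
    is a norm of higher index.  On S_(-1), where p is controlled by finitely many
    bounded subsets B of S_1, the numbers sup_(x in B) |x_al| serve as a_al.  They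
    decrease faster than every power of (2N)^al, hence the multiples
    a_al (2N)^(2 al) e_al again form a bounded subset of S_1, and the dual seminorm
    of that subset is q. *)

Set Implicit Arguments.
Unset Strict Implicit.
Unset Printing Implicit Defensive.

Import Order.TTheory GRing.Theory Num.Theory.
Import numFieldTopology.Exports numFieldNormedType.Exports.

Local Open Scope classical_set_scope.
Local Open Scope ring_scope.
Local Open Scope complex_scope.

(* On R[i], the notation of complex_scope denotes conjc, whereas the scalar
   product of weighted l^2 is written with Num.conj. *)
Local Notation "z ^*" := (Num.conj z) : complex_scope.

(** * Unconditional sums of nonnegative families *)

Section esum_facts.
Context {R : realType}.
Local Open Scope ereal_scope.

Lemma esumZl (I : choiceType) (c : R) (a : I -> \bar R) : (0 <= c)%R ->
  (forall i, 0 <= a i) ->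
  \esum_(i in [set: I]) (c%:E * a i) = c%:E * \esum_(i in [set: I]) a i.
Proof.
rewrite le_eqVlt => /predU1P[<- a0|c0 a0].
  by rewrite mul0e esum1// => i _; rewrite mul0e.
apply/eqP; rewrite eq_le esumZl_le ?(ltW c0)//=.
rewrite -lee_pdivlMl//.
have -> : \esum_(i in [set: I]) a i
    = \esum_(i in [set: I]) (c^-1%:E * (c%:E * a i)).
  by apply: eq_esum => i _; rewrite muleA -EFinM mulVf ?gt_eqF// mul1e.
apply: esumZl_le; first by rewrite invr_ge0 ltW.
by move=> i; rewrite mule_ge0 ?lee_fin// ltW.
Qed.

Lemma esum_pair (I J : choiceType) (a : I * J -> \bar R) :
  (forall k, 0 <= a k) ->
  \esum_(k in [set: I * J]) a k
    = \esum_(i in [set: I]) \esum_(j in [set: J]) a (i, j).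
Proof.
move=> a0; rewrite (esum_esum (J := fun=> setT) (a := fun i j => a (i, j)))//.
rewrite (_ : [set: I] `*`` _ = setT).
  by apply: eq_esum => -[].
by apply/seteqP; split.
Qed.

Lemma exchange_esum (I J : choiceType) (a : I -> J -> \bar R) :
  (forall i j, 0 <= a i j) ->
  \esum_(i in [set: I]) \esum_(j in [set: J]) a i j
    = \esum_(j in [set: J]) \esum_(i in [set: I]) a i j.
Proof.
move=> a0; rewrite -(esum_pair (a := fun k => a k.1 k.2))//.
rewrite -(esum_pair (a := fun k => a k.2 k.1))//.
rewrite (@reindex_esum _ _ _ setT setT (fun k : J * I => (k.2, k.1)))//.
split => [//|[? ?] [? ?] _ _ [-> ->]//|[i j] _]; by exists (j, i).
Qed.

Lemma esum_ge_term (I : choiceType) (a : I -> \bar R) i :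
  (forall i, 0 <= a i) -> a i <= \esum_(i in [set: I]) a i.
Proof.
move=> a0; apply: esum_ge; exists [set i]; last by rewrite fsbig_set1.
by split => //; exact: finite_set1.
Qed.

Lemma esum_nat_le (a : nat -> \bar R) (M : \bar R) : (forall n, 0 <= a n) ->
  (forall n, \sum_(0 <= i < n) a i <= M) -> \esum_(i in [set: nat]) a i <= M.
Proof.
move=> a0 aM; rewrite -nneseries_esumT//; apply: lime_le.
  by apply: is_cvg_nneseries => n _ _.
by apply: nearW => n; exact: aM.
Qed.

End esum_facts.

(** * The word sum as a geometric series *)

Section words.
Context {R : realType}.
Implicit Types (h : nat -> R) (al : seq nat).
Local Open Scope ereal_scope.

(** A word is empty or consists of a first letter and a word: the sum over words
    obeys the recursion that drives the geometric series. *)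
Lemma esum_words (F : seq nat -> \bar R) : (forall al, 0 <= F al) ->
  \esum_(al in [set: seq nat]) F al = F [::] +
  \esum_(k in [set: nat]) \esum_(al in [set: seq nat]) F (k :: al).
Proof.
move=> F0; rewrite (esumID [set [::]])// setTI esum_set1//; congr (_ + _).
rewrite -(esum_pair (a := fun k => F (k.1 :: k.2)))// setTI.
apply: reindex_esum.
split => [//|[? ?] [? ?] _ _ [-> ->]//|].
by move=> [[]//|k al _]; exists (k, al).
Qed.

(** By [esum_words] the sum S satisfies S = 1 + T S, which determines S once S is
    known to be finite.  The sums over the words of length at most n satisfy
    S_0 = 1 and S_(n+1) = 1 + T S_n, hence stay below 1 / (1 - T), and every finite
    set of words is contained in one of these ranges. *)
Lemma esum_words_prod h (T : R) : (forall k, 0 <= h k)%R -> (T < 1)%R ->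
  \esum_(k in [set: nat]) (h k)%:E = T%:E ->
  \esum_(al in [set: seq nat]) (\prod_(k <- al) h k)%:E = ((1 - T)^-1)%:E.
Proof.
move=> h0 T1 hT.
have T0 : (0 <= T)%R.
  by rewrite -lee_fin -hT; apply: esum_ge0 => k _; rewrite lee_fin.
have oT : (0 < 1 - T)%R by rewrite subr_gt0.
pose P al := (\prod_(k <- al) h k)%R.
have P0 al : (0 <= P al)%R by apply: prodr_ge0 => k _.
have PE k al : P (k :: al) = (h k * P al)%R by rewrite /P big_cons.
pose S n := \esum_(al in [set: seq nat]) (if (size al <= n)%N then (P al)%:E else 0).
have S_le n : S n <= ((1 - T)^-1)%:E.
  have i0 m al : 0 <= (if (size al <= m)%N then (P al)%:E else 0).
    by case: ifP => // _; rewrite lee_fin.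
  have S0 : forall m, 0 <= S m by move=> m; exact: esum_ge0.
  elim: n => [|n IH]; rewrite /S esum_words//=.
    rewrite esum1 => [|k _]; last by rewrite esum1.
    by rewrite adde0 lee_fin /P big_nil invf_ge1// lerBlDr lerDl.
  have -> : \esum_(k in [set: nat]) \esum_(al in [set: seq nat])
      (if (size al < n.+1)%N then (P (k :: al))%:E else 0)
      = \esum_(k in [set: nat]) (h k)%:E * S n.
    apply: eq_esum => k _; rewrite -esumZl//.
    apply: eq_esum => al _; rewrite ltnS PE; case: ifP => _; last by rewrite mule0.
    by rewrite EFinM.
  have SE : S n = (fine (S n))%:E.
    by rewrite fineK// ge0_fin_numE// (le_lt_trans IH)// ltry.
  move: IH; rewrite SE; under eq_esum do rewrite muleC.
  rewrite esumZl ?fine_ge0//.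
  rewrite hT -EFinM /P big_nil -EFinD !lee_fin => IH.
  rewrite (_ : (1 - T)^-1 = 1 + (1 - T)^-1 * T)%R; last by field; rewrite gt_eqF.
  by rewrite lerD2l ler_wpM2r.
have Ple : \esum_(al in [set: seq nat]) (P al)%:E <= ((1 - T)^-1)%:E.
  apply: ge_ereal_sup => _ [X [finX _] <-].
  pose n := (\max_(al <- fset_set X) size al)%N.
  apply: le_trans (S_le n).
  apply: esum_ge; exists X => //.
  rewrite le_eqVlt; apply/orP; left; apply/eqP; apply: eq_fsbigr => al alX.
  rewrite (_ : (_ <= _)%N)//; apply: leq_bigmax_seq => //.
  by rewrite in_fset_set.
have Pge0 : 0 <= \esum_(al in [set: seq nat]) (P al)%:E.
  by apply: esum_ge0 => al _; rewrite lee_fin.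
have SE : \esum_(al in [set: seq nat]) (P al)%:E
    = (fine (\esum_(al in [set: seq nat]) (P al)%:E))%:E.
  by rewrite fineK// ge0_fin_numE// (le_lt_trans Ple)// ltry.
have : \esum_(al in [set: seq nat]) (P al)%:E
   = 1 + T%:E * \esum_(al in [set: seq nat]) (P al)%:E.
  rewrite {1}esum_words//.
  rewrite /P big_nil -/P; congr (_ + _).
  rewrite SE muleC -hT -esumZl ?fine_ge0//.
  apply: eq_esum => k _; rewrite -SE muleC -esumZl//.
  by apply: eq_esum => al _; rewrite big_cons EFinM.
rewrite SE -EFinM -EFinD => -[] e; congr EFin.
apply: (mulIf (lt0r_neq0 oT)); rewrite mulVf ?gt_eqF//.
by rewrite mulrBr mulr1 {1}e; ring.
Qed.

End words.

Section zeta_sums.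
Context {R : realType}.
Variable s : int.
Hypothesis s2 : 2 <= s.

Let a (k : nat) : R := k.+1%:R ^ (- s).

Let a_ge0 k : 0 <= a k. Proof. by rewrite exprz_ge0. Qed.

Let a_le k : a k <= (k.+1%:R ^+ 2)^-1.
Proof.
rewrite /a exprnN; apply: ler_weXz2l; first by rewrite ler1n.
by rewrite lerN2.
Qed.

(** 1 / k^2 <= 1 / (k - 1) - 1 / k, so that the partial sums telescope. *)
Let suma n : \sum_(0 <= i < n) a i <= 2.
Proof.
suff: \sum_(0 <= i < n.+1) a i <= 2 - n.+1%:R^-1.
  move=> h; apply: (@le_trans _ _ (\sum_(0 <= i < n.+1) a i)).
    by rewrite big_nat_recr //= lerDl.
  by rewrite (le_trans h)// gerBl invr_ge0.
elim: n => [|n IH].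
  by rewrite big_nat1 (le_trans (a_le 0))// expr1n !invr1; lra.
rewrite big_nat_recr //= (le_trans (lerD IH (a_le _)))//.
rewrite -[n.+2%:R]natr1; set x := n.+1%:R; have x0 : 0 < x by rewrite ltr0n.
rewrite -subr_ge0.
suff -> : 2 - (x + 1)^-1 - (2 - x^-1 + ((x + 1) ^+ 2)^-1) = (x * (x + 1) ^+ 2)^-1.
  by rewrite invr_ge0 mulr_ge0 ?sqr_ge0 ?ltW.
by field; rewrite gt_eqF// gt_eqF// ltr_wpDr.
Qed.

Let esum_a : (\esum_(k in [set: nat]) (a k)%:E <= 2%:E)%E.
Proof.
apply: esum_nat_le => n; first by rewrite lee_fin.
by rewrite sumEFin lee_fin suma.
Qed.

Lemma esum_zeta : (\esum_(k in [set: nat]) (a k)%:E = (zeta (s%:~R : R))%:E)%E.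
Proof.
have a0 n : true -> (0 <= (a n)%:E)%E by rewrite lee_fin.
rewrite -nneseries_esumT; last by move=> n; exact: a0.
rewrite (@summable_nneseries_lim _ xpredT)//.
- congr (limn _)%:E; apply/funext => n /=; apply: eq_bigr => k _ /=.
  by rewrite /a -powR_intmul// rmorphN.
- rewrite /summable (_ : (fun=> _) = setT); last by apply/seteqP; split.
  under eq_esum do rewrite gee0_abs ?lee_fin//.
  by apply: le_lt_trans esum_a _; rewrite ltry.
Qed.

Lemma zeta_le2 : zeta (s%:~R : R) <= 2.
Proof. by rewrite -lee_fin -esum_zeta. Qed.

Lemma letter_sum : (\esum_(k in [set: nat]) ((2 * k.+1)%N%:R ^ (- s))%:E
  = (2 ^ (- s) * zeta (s%:~R : R))%:E)%E.
Proof.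
rewrite EFinM -esum_zeta -esumZl ?exprz_ge0//.
by apply: eq_esum => k _; rewrite -EFinM natrM expfzMl.
Qed.

(** Ensures that the geometric series converges; the bound is 2^(-2) * 2. *)
Lemma letter_sum_lt1 : 2 ^ (- s) * zeta (s%:~R : R) < 1.
Proof.
have h : 2 ^ (- s) <= 4^-1 :> R.
  rewrite (_ : 4 = 2 ^+ 2); last by ring.
  by rewrite exprnN; apply: ler_weXz2l; rewrite ?ler1n// lerN2.
apply: (@le_lt_trans _ _ (4^-1 * 2)); last by lra.
by rewrite (le_trans (ler_wpM2l _ zeta_le2)) ?exprz_ge0// ler_wpM2r.
Qed.

End zeta_sums.

Section twoN_sums.
Context {R : realType}.

Lemma twoN_exprz (s : int) (al : seq nat) :
  (twoN al)%:R ^ s = \prod_(k <- al) ((2 * k.+1)%N%:R ^ s) :> R.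
Proof.
rewrite /twoN; elim: al => [|k al IH]; first by rewrite !big_nil exp1rz.
by rewrite !big_cons natrM expfzMl IH.
Qed.

Lemma twoN_sum (s : int) : 2 <= s ->
  (\esum_(al in [set: seq nat]) ((twoN al)%:R ^ (- s) : R)%:E =
   (1 / (1 - 2 ^ (- s) * zeta (s%:~R : R)))%:E)%E.
Proof.
move=> s2; under eq_esum do rewrite twoN_exprz.
rewrite (esum_words_prod (T := 2 ^ (- s) * zeta (s%:~R : R))) ?div1r//.
- by move=> k; rewrite exprz_ge0.
- exact: letter_sum_lt1.
- exact: letter_sum.
Qed.

End twoN_sums.

(** * Parseval's identity in weighted l^2 *)

Section l2_facts.
Context {R : realType}.

Lemma sqnorm_fin (I : choiceType) (w : weight R I) (f : l2 w) :
  exists2 A : R, sqnorm w f = A%:E & 0 <= A.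
Proof.
have w0 i : 0 <= w i by exact/ltW/weight_gt0.
have := l2_finE (l2_valP f) => e; exists (fine (norm2 w f) ^+ 2); last first.
  exact: sqr_ge0.
by rewrite -norm2K// e EFin_expe.
Qed.

End l2_facts.

Section complex_facts.
Context {R : realType}.
Implicit Types z t : R[i].

Lemma conjCM z t : (z * t)^* = z^* * t^*. Proof. exact: rmorphM. Qed.

Lemma conjCD z t : (z + t)^* = z^* + t^*. Proof. exact: rmorphD. Qed.

Lemma complexRM (x y : R) : (x * y)%:C = x%:C * y%:C. Proof. exact: rmorphM. Qed.

Lemma conjc_0 : (0 : R[i])^* = 0. Proof. exact: rmorph0. Qed.

Lemma cabs_conj z : cabs z^* = cabs z.
Proof. by apply/(@complexI R); rewrite -!Defs.normcE norm_conjC. Qed.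

Lemma cabs_real (x : R) : cabs x%:C = `|x|.
Proof. by rewrite /cabs /= expr0n /= addr0 sqrtr_sqr. Qed.

Lemma mul_conj z : z * z^* = (cabs z ^+ 2)%:C.
Proof. by rewrite -normCK Defs.normcE rmorphXn. Qed.

Lemma conj_real (x : R) : (x%:C)^* = x%:C.
Proof. exact: conjc_real. Qed.

Lemma cabs_eq0 z : cabs z = 0 -> z = 0.
Proof. exact: Normc.eq0_normc. Qed.

Lemma cabs_delta (b : bool) : cabs (b%:R : R[i]) = b%:R.
Proof. by case: b; rewrite ?cabs0// -[1](rmorph1 (@real_complex R)) cabs_real normr1. Qed.

End complex_facts.

Section esum_single.
Context {R : realType} {I : choiceType}.

Lemma esum_single (a : I -> \bar R) i : (0 <= a i)%E ->
  (forall j, j != i -> a j = 0%E) -> (\esum_(j in [set: I]) a j = a i)%E.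
Proof.
move=> ai0 a0; rewrite (esumID [set i]); last first.
  by move=> j _; have [->|/a0 ->] := eqVneq j i.
rewrite setTI esum_set1// esum1 ?adde0// => j [_ /= /eqP]; exact: a0.
Qed.

End esum_single.

Section csum_facts.
Context {R : realType} {I : choiceType}.
Implicit Types f g : I -> R[i].

Lemma csum_lim f (z : R[i]) :
  (summability.partial_sum (f : I -> R[i]^o) @ summability.totally --> (z : R[i]^o)) ->
  csum f = z.
Proof. by move=> h; apply: (@cvg_lim R[i]^o) => //. Qed.

Lemma csum_conj f : abs_summable f -> csum (fun i => (f i)^*) = (csum f)^*.
Proof.
move=> fs; apply: csum_lim; apply/cvgrPdist_lt => e e0.
have /cvgrPdist_lt/(_ e e0) := csum_cvg fs.
apply: filterS => A; apply: le_lt_trans.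
rewrite /summability.partial_sum -(norm_conjC (csum f - _)) rmorphB /=.
by rewrite rmorph_sum.
Qed.

Lemma csum_single f i : (forall j, j != i -> f j = 0) -> csum f = f i.
Proof.
move=> f0; apply: csum_lim; apply: (@cvg_near_cst _ R[i]^o).
exists [fset i]%fset => // A /= /fsubsetP iA.
rewrite /summability.partial_sum.
have -> : (\sum_(j : A) f (\val j)) = \sum_(j <- A) f j by rewrite big_seq_fsetE.
rewrite (big_fsetD1 i) /=; last by apply: iA; rewrite inE.
rewrite big_seq big1 ?addr0// => j; rewrite !inE => /andP[ji _]; exact: f0.
Qed.

End csum_facts.

Section l2_dot_theory.
Context {R : realType} {I : choiceType} {w : weight R I}.
Implicit Types f g h : l2 w.

Lemma w_ge0 i : 0 <= w i. Proof. exact/ltW/weight_gt0. Qed.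

Lemma l2_ext f g : (forall i, f i = g i) -> f = g.
Proof. by move=> h; apply: val_inj; apply/funext. Qed.

Definition nsq f : R := fine (sqnorm w f).

Lemma nsqE f : sqnorm w f = (nsq f)%:E.
Proof. by rewrite /nsq; have [A -> _] := sqnorm_fin f. Qed.

Lemma nsq_ge0 f : 0 <= nsq f.
Proof. by rewrite -lee_fin -nsqE; apply: sqnorm_ge0 => i; exact: w_ge0. Qed.

Lemma norm2_lt f (e : R) : 0 < e -> (norm2 w f < e%:E)%E = (nsq f < e ^+ 2).
Proof.
move=> e0; have n0 := norm2_ge0 w f.
rewrite -lte_fin -nsqE -norm2K; last by move=> i; exact: w_ge0.
by rewrite (l2_finE (l2_valP f)) -EFin_expe !lte_fin ltr_sqr// nnegrE ?fine_ge0// ltW.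
Qed.

Lemma coord_le_nsq f i : w i * cabs (f i) ^+ 2 <= nsq f.
Proof.
rewrite -lee_fin -nsqE; apply: (esum_ge_term (a := fun i => (w i * cabs (f i) ^+ 2)%:E)).
by move=> j; rewrite lee_fin mulr_ge0 ?sqr_ge0 ?w_ge0.
Qed.

Lemma dot_summable f g : abs_summable (fun i => (w i)%:C * f i * (g i)^*).
Proof.
apply: (@le_lt_trans _ _ (sqnorm w f + sqnorm w g)%E); last first.
  by rewrite !nsqE -EFinD ltry.
rewrite -esumD; try by move=> i _; rewrite lee_fin mulr_ge0 ?sqr_ge0 ?w_ge0.
apply: le_esum => i _; rewrite -EFinD lee_fin !cabsM cabs_conj cabs_real.
rewrite ger0_norm ?w_ge0// -mulrDr -mulrA ler_wpM2l ?w_ge0//.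
set a := cabs _; set b := cabs _.
have a0 : 0 <= a by exact: cabs_ge0.
have b0 : 0 <= b by exact: cabs_ge0.
have : 0 <= (a - b) ^+ 2 by exact: sqr_ge0.
have : 0 <= a * b by rewrite mulr_ge0.
rewrite sqrrB; lra.
Qed.

Lemma dotDl f g h : l2_dot w (f + g) h = l2_dot w f h + l2_dot w g h.
Proof.
rewrite /l2_dot -csumD; try exact: dot_summable.
by congr csum; apply/funext => i; rewrite fctE /= mulrDr mulrDl.
Qed.

Lemma dotZl (a : R[i]) f h : l2_dot w (a *: f) h = a * l2_dot w f h.
Proof.
rewrite /l2_dot -csumZ; last exact: dot_summable.
congr csum; apply/funext => i; rewrite fctE /=.
by rewrite [(_ : R[i]) * _ * _](_ : _ = (w i)%:C * (a * f i) * (h i)^*)// -!mulrA mulrCA.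
Qed.

Lemma dotC f g : l2_dot w g f = (l2_dot w f g)^*.
Proof.
rewrite /l2_dot -csum_conj; last exact: dot_summable.
congr csum; apply/funext => i; by rewrite !conjCM conj_real conjCK mulrAC.
Qed.

Lemma dotDr f g h : l2_dot w h (f + g) = l2_dot w h f + l2_dot w h g.
Proof. by rewrite dotC dotDl conjCD -!dotC. Qed.

Lemma dotZr (a : R[i]) f h : l2_dot w h (a *: f) = a^* * l2_dot w h f.
Proof. by rewrite dotC dotZl conjCM -!dotC. Qed.

Lemma dot0r f : l2_dot w f (0 : l2 w) = 0.
Proof. by rewrite -(scale0r (0 : l2 w)) dotZr conjc_0 mul0r. Qed.

Lemma dotNr f g : l2_dot w f (- g) = - l2_dot w f g.
Proof. by rewrite -scaleN1r dotZr rmorphN1 mulN1r. Qed.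

Lemma dot_self f : l2_dot w f f = (nsq f)%:C.
Proof.
have E i : (w i)%:C * f i * (f i)^* = (w i * cabs (f i) ^+ 2)%:C.
  by rewrite -mulrA mul_conj complexRM.
rewrite /l2_dot (_ : (fun i => _) = fun i => (w i * cabs (f i) ^+ 2)%:C); last first.
  by apply/funext => i; exact: E.
apply: csum_lim; apply: real_sum_cvg => [i|].
  by rewrite mulr_ge0 ?sqr_ge0 ?w_ge0.
by rewrite -/(sqnorm w f) nsqE ltry.
Qed.

Lemma pythagoras f g : l2_dot w f g = 0 -> nsq (f + g) = nsq f + nsq g.
Proof.
move=> fg; apply: (@complexI R).
rewrite rmorphD /= -!dot_self dotDl !dotDr (dotC f g) fg conjc_0.
by rewrite addr0 add0r.
Qed.

Lemma dot_sumr (J : eqType) (s : seq J) (c : J -> R[i]) (u : J -> l2 w) f :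
  l2_dot w f (\sum_(j <- s) c j *: u j : l2 w)
    = \sum_(j <- s) (c j)^* * l2_dot w f (u j).
Proof.
elim: s => [|j s IH]; first by rewrite !big_nil dot0r.
by rewrite !big_cons dotDr dotZr IH.
Qed.

(** For a finite duplicate-free s, P f s is the orthogonal projection of f on the
    span of the u_j, j in s.  Pythagoras gives the Bessel equality, and the best
    approximation property of P f s turns density of the span into equality. *)
Section parseval.
Context {J : choiceType} (u : J -> l2 w).
Hypothesis u_basis : orthonormal_basis u.

Let cf f j : R[i] := l2_dot w f (u j).
Let P f (s : seq J) : l2 w := \sum_(j <- s) cf f j *: u j.

Let dot_uP f (s : seq J) k : uniq s -> k \in s -> l2_dot w (u k) (P f s) = (cf f k)^*.
Proof.
move=> us ks; rewrite dot_sumr (bigD1_seq k)//= u_basis.1 eqxx mulr1.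
by rewrite big1 ?addr0// => j jk; rewrite u_basis.1 eq_sym (negbTE jk) mulr0.
Qed.

Let dot_Du f (s : seq J) k : uniq s -> k \in s -> l2_dot w (f - P f s) (u k) = 0.
Proof.
by move=> us ks; rewrite dotC dotDr dotNr dot_uP// -dotC -/(cf f k) dotC subrr conjc_0.
Qed.

Let dot_D_span f (s t : seq J) (c : J -> R[i]) : uniq s -> {subset t <= s} ->
  l2_dot w (f - P f s) (\sum_(j <- t) c j *: u j : l2 w) = 0.
Proof.
move=> us ts; rewrite dot_sumr big_seq big1// => j jt.
by rewrite dot_Du ?mulr0// ts.
Qed.

Let nsqP f (s : seq J) : uniq s -> nsq (P f s) = \sum_(j <- s) cabs (cf f j) ^+ 2.
Proof.
move=> us; apply: (@complexI R); rewrite -dot_self rmorph_sum /= dot_sumr.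
rewrite big_seq [RHS]big_seq; apply: eq_bigr => j js.
by rewrite dotC dot_uP// conjCK mulrC mul_conj.
Qed.

Let bessel_eq f (s : seq J) : uniq s ->
  nsq f = nsq (f - P f s) + \sum_(j <- s) cabs (cf f j) ^+ 2.
Proof.
move=> us; rewrite -nsqP// -pythagoras ?subrK//.
exact: dot_D_span.
Qed.

(** An approximating combination may repeat indices, whereas the Bessel equality
    holds for duplicate-free lists; hence undup. *)
Let best_approx f (s : seq J) (c : J -> R[i]) :
  nsq (f - P f (undup s)) <= nsq (f - \sum_(j <- s) c j *: u j).
Proof.
set g : l2 w := \sum_(j <- s) _.
have -> : f - g = (f - P f (undup s)) + (P f (undup s) - g).
  by rewrite addrA subrK.
rewrite [leRHS]pythagoras ?lerDl ?nsq_ge0//.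
rewrite dotDr dotNr !dot_D_span ?undup_uniq ?subr0//.
by move=> j; rewrite mem_undup.
Qed.

Lemma parseval f :
  (\esum_(j in [set: J]) (cabs (l2_dot w f (u j)) ^+ 2)%:E = sqnorm w f)%E.
Proof.
apply/eqP; rewrite eq_le; apply/andP; split.
  apply: ge_ereal_sup => _ [A [finA _] <-].
  rewrite fsbig_finite//= sumEFin nsqE lee_fin.
  by rewrite (bessel_eq f (fset_uniq (fset_set A))) lerDr nsq_ge0.
rewrite nsqE; apply/lee_addgt0Pr => e e0.
have se0 : 0 < Num.sqrt e by rewrite sqrtr_gt0.
have [s [c]] := u_basis.2 f _ se0.
rewrite norm2_lt// sqr_sqrtr ?(ltW e0)// => h.
rewrite (bessel_eq f (undup_uniq s)) addrC EFinD.
apply: leeD; last first.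
  by rewrite lee_fin (le_trans (best_approx _ _ _) (ltW h)).
apply: esum_ge; exists [set` undup s]; first by split => //; exact: finite_seq.
by rewrite -fsbig_seq ?undup_uniq// sumEFin.
Qed.

End parseval.

End l2_dot_theory.

(** * The second quantized embedding *)

Section delta_vectors.
Context {R : realType} {I : choiceType}.

Definition delta (a : I) : I -> R[i] := fun i => (i == a)%:R.

Lemma sqnorm_delta (w : weight R I) a : sqnorm w (delta a) = (w a)%:E.
Proof.
rewrite /sqnorm (esum_single (i := a)).
- by rewrite /delta eqxx cabs_delta expr1n mulr1.
- by rewrite lee_fin mulr_ge0 ?sqr_ge0 ?w_ge0.
- by move=> j ja; rewrite /delta (negbTE ja) cabs_delta expr0n mulr0.
Qed.

Lemma delta_l2 (w : weight R I) a : delta a \in l2_pred w.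
Proof.
rewrite inE /norm2 sqnorm_delta poweR_EFin; exact: ltry.
Qed.

Definition ldelta (w : weight R I) a : l2 w := L2 (delta_l2 w a).

Lemma sum_delta (s : seq I) (c : I -> R[i]) i : uniq s ->
  \sum_(j <- s) c j * delta j i = if i \in s then c i else 0.
Proof.
move=> us; case: ifPn => [is_|is_].
  rewrite (bigD1_seq i)//= /delta eqxx mulr1 big1 ?addr0// => j ji.
  by rewrite eq_sym (negbTE ji) mulr0.
rewrite big_seq big1// => j js; rewrite /delta.
have [ij|_] := eqVneq i j; last by rewrite mulr0.
by move: is_; rewrite ij js.
Qed.

Variable w : weight R I.

Lemma l2_val_sum (J : Type) (s : seq J) (F : J -> l2 w) i :
  (\sum_(j <- s) F j : l2 w) i = \sum_(j <- s) F j i.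
Proof.
elim: s => [|j s IH]; first by rewrite !big_nil.
by rewrite !big_cons -IH.
Qed.

Lemma dot_delta (f : l2 w) a : l2_dot w (ldelta w a) f = (w a)%:C * (f a)^*.
Proof.
rewrite /l2_dot (csum_single (i := a)) /= /delta ?eqxx ?mulr1// => j ja.
by rewrite (negbTE ja) mulr0 mul0r.
Qed.

(** Truncating to a finite set of indices that carries almost all of the squared
    norm: the finitely supported vectors are dense. *)
Lemma l2_tail (f : l2 w) (e : R) : 0 < e -> exists s : seq I,
  (norm2 w (f - \sum_(j <- s) f j *: ldelta w j)%R < e%:E)%E.
Proof.
move=> e0; have e20 : 0 < e ^+ 2 by rewrite exprn_gt0.
pose a i : \bar R := (w i * cabs (f i) ^+ 2)%:E.
have a0 i : (0 <= a i)%E by rewrite lee_fin mulr_ge0 ?sqr_ge0 ?w_ge0.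
have : (sqnorm w f - (e ^+ 2)%:E < sqnorm w f)%E.
  by rewrite nsqE -EFinB lte_fin ltrBlDr ltrDl.
move=> /ereal_sup_gt[_ [A [finA _] <-] SA].
exists (fset_set A); rewrite norm2_lt//.
have memA i : (i \in fset_set A) = (i \in A) by rewrite in_fset_set.
rewrite -lte_fin -nsqE /sqnorm.
have E i : (w i * cabs ((f - \sum_(j <- fset_set A) f j *: ldelta w j) i) ^+ 2)%:E
    = if i \in ~` A then a i else 0%E.
  rewrite -[(_ - _ : l2 w) i]/(f i - (\sum_(j <- fset_set A) f j *: ldelta w j : l2 w) i).
  rewrite l2_val_sum (sum_delta f i (fset_uniq _)) memA in_setC.
  case: ifPn => _ /=; last by rewrite subr0.
  by rewrite subrr cabs0 expr0n mulr0.
under eq_esum do rewrite E.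
rewrite -esum_mkcond.
have := @esumID R I A setT a (fun i _ => a0 i); rewrite !setTI => S2.
have SA' : (\esum_(i in A) a i = \sum_(i \in A) a i)%E.
  by rewrite -[A in LHS]set_mem_set esum_fset set_mem_set.
move: SA; rewrite -SA' => SA.
have fS : \esum_(i in setT) a i \is a fin_num by rewrite -/(sqnorm w f) nsqE.
have C0 : (0 <= \esum_(i in ~` A) a i)%E by exact: esum_ge0.
have A0 : (0 <= \esum_(i in A) a i)%E by exact: esum_ge0.
move: SA S2 fS C0 A0; rewrite /sqnorm -/a.
move: (\esum_(i in setT) a i) (\esum_(i in A) a i) (\esum_(i in ~` A) a i).
move=> [s| |] [x| |] [y| |]//=.
rewrite -EFinB -EFinD !lte_fin => SA [sE] _ _ _; lra.
Qed.

(** Witness that the orthonormal basis picked in the definition of the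
    Hilbert-Schmidt norm does exist: the normalized vectors delta_i / sqrt (w i). *)
Lemma delta_basis : exists u : I -> l2 w, orthonormal_basis u.
Proof.
pose c i : R := (Num.sqrt (w i))^-1.
exists (fun i => (c i)%:C *: ldelta w i); split.
  move=> j k; rewrite dotZl dotZr dot_delta /= /delta conj_real.
  rewrite eq_sym; have [->|] := eqVneq j k; last first.
    by move=> _; rewrite conjc_0 !mulr0.
  rewrite rmorph1 mulr1 -!complexRM.
  have s0 : Num.sqrt (w k) != 0 by rewrite gt_eqF// sqrtr_gt0 weight_gt0.
  suff -> : c k * (c k * w k) = 1 by [].
  by rewrite -{1}(sqr_sqrtr (w_ge0 k)) /c; field.
move=> f e e0; have [s fs] := l2_tail f e0.
exists s, (fun j => f j * (Num.sqrt (w j))%:C).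
rewrite (eq_bigr (fun j => f j *: ldelta w j))// => j _.
have s0 : Num.sqrt (w j) != 0 by rewrite gt_eqF// sqrtr_gt0 weight_gt0.
by rewrite scalerA -mulrA -complexRM /c mulfV// mulr1.
Qed.

End delta_vectors.

Section inclusions.
Context {R : realType} {I : choiceType}.

Lemma sqnorm_mono (w w' : weight R I) (f : I -> R[i]) : (forall i, w i <= w' i) ->
  (sqnorm w f <= sqnorm w' f)%E.
Proof.
by move=> ww'; apply: le_esum => i _; rewrite lee_fin ler_wpM2r ?sqr_ge0.
Qed.

Lemma norm2_mono (w w' : weight R I) (f : I -> R[i]) : (forall i, w i <= w' i) ->
  (norm2 w f <= norm2 w' f)%E.
Proof.
move=> ww'; apply: gt0_ler_poweR; rewrite ?in_itv/= ?leey ?andbT ?invr_ge0//.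
- by apply: sqnorm_ge0 => i; exact: w_ge0.
- by apply: sqnorm_ge0 => i; exact: w_ge0.
- exact: sqnorm_mono.
Qed.

Lemma l2_pred_mono (w w' : weight R I) (f : I -> R[i]) : (forall i, w i <= w' i) ->
  f \in l2_pred w' -> f \in l2_pred w.
Proof. by move=> ww'; rewrite !inE; exact: le_lt_trans (norm2_mono _ ww'). Qed.

Lemma norm2_eq0 (w : weight R I) (f : I -> R[i]) : norm2 w f = 0%E -> f = 0.
Proof.
move=> f0; have fw : f \in l2_pred w by rewrite inE f0.
apply/funext => i; apply: cabs_eq0.
have := coord_le_nsq (L2 fw) i; rewrite /nsq /= -norm2K ?f0; last exact: w_ge0.
rewrite expe2 mule0 /= pmulr_rle0 ?weight_gt0// => h.
by apply/eqP; rewrite -sqrf_eq0 eq_le h sqr_ge0.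
Qed.

End inclusions.

Section fock_map_inclusion.
Context {R : realType} (p q : int) (pq : p <= q).

Lemma word_weight_mono al : word_weight R p al <= word_weight R q al.
Proof. by rewrite /= ler_weXz2l// ler1n twoN_gt0. Qed.

Lemma letter_weight_mono n : letter_weight R p n <= letter_weight R q n.
Proof. by rewrite /= ler_weXz2l// ler1n. Qed.

Definition fock_emb (f : fock R q) : fock R p :=
  L2 (l2_pred_mono word_weight_mono (l2_valP f)).

Lemma T_embE (x : Hsp R q) : T_emb p x = x :> (nat -> R[i]).
Proof.
rewrite /T_emb insubdK//; exact: (l2_pred_mono letter_weight_mono (l2_valP x)).
Qed.

(** The vectors e_al are elementary tensors, which is how the characterization of
    the second quantization on tensors determines it on a dense subspace. *)
Lemma tensor_delta (al : seq nat) :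
  tensor [seq delta k | k <- al] = delta al :> (seq nat -> R[i]).
Proof.
apply/funext => be; rewrite /tensor /delta size_map.
case: eqP => [sz|]; last first.
  by move=> h; case: eqP => // e; case: h; rewrite e.
case: eqP => [->|ne].
  apply: big1 => k _; rewrite (nth_map 0%N)// /delta eqxx//.
apply/eqP; rewrite prodf_seq_eq0; apply/hasP.
case: (boolP [exists k : 'I_(size al), nth 0%N be k != nth 0%N al k]).
  move=> /existsP[k bk]; exists k; first by rewrite mem_index_enum.
  by rewrite (nth_map 0%N)// /= /delta (negbTE bk) eqxx.
rewrite negb_exists => /forallP h; case: ne.
apply: (@eq_from_nth _ 0%N) => // i; rewrite sz => ia.
by have := h (Ordinal ia); rewrite negbK => /eqP.
Qed.

Lemma fock_emb_is_fock_map : is_fock_map (@T_emb R q p) fock_emb.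
Proof.
split.
- by move=> a f g; apply: l2_ext.
- exists 1 => f; rewrite mul1e; exact: (norm2_mono _ word_weight_mono).
- move=> xs F FE; rewrite /= FE; congr tensor.
  by apply: eq_map => x; rewrite T_embE.
Qed.

(** The difference B of the two maps is linear and bounded and vanishes on every
    e_al, hence on a dense subspace, hence everywhere. *)
Lemma fock_map_unique (A : fock R q -> fock R p) :
  is_fock_map (@T_emb R q p) A -> A = fock_emb.
Proof.
move=> [linA [M AM] tA]; apply/funext => f; apply/eqP; rewrite -subr_eq0; apply/eqP.
have Adelta al : A (ldelta _ al) = fock_emb (ldelta _ al).
  apply: val_inj => /=; rewrite -tensor_delta.
  have := tA [seq ldelta (letter_weight R q) k | k <- al] (ldelta _ al).
  rewrite -!map_comp /= -tensor_delta => /(_ erefl) ->; congr tensor.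
  by apply: eq_map => k /=; rewrite T_embE.
pose B f := A f - fock_emb f.
have linB a g h : B (a *: g + h) = a *: B g + B h.
  rewrite /B linA (_ : fock_emb (a *: g + h) = a *: fock_emb g + fock_emb h); last first.
    exact: l2_ext.
  by rewrite scalerBr opprD addrACA.
have B0 : B 0 = 0.
  have := linB (-1) 0 0; rewrite scaler0 addr0 scaleN1r addNr; exact.
(* The constant M of A may be negative, and the inclusion contributes 1. *)
have BM g : (norm2 (word_weight R p) (B g)
    <= (Num.max M 0 + 1)%:E * norm2 (word_weight R q) g)%E.
  have w0 r i : 0 <= word_weight R r i by exact: w_ge0.
  have -> : B g = A g + (-1) *: fock_emb g by rewrite scaleN1r.
  apply: (le_trans (norm2D (w0 p) _ _)).
  apply: (@le_trans _ _ (M%:E * norm2 (word_weight R q) g + norm2 (word_weight R q) g)%E).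
    apply: leeD; first exact: AM.
    apply: (le_trans (norm2Z_le (w0 p) _ _)).
    rewrite cabsN (cabs_delta true) mul1e.
    exact: (norm2_mono _ word_weight_mono).
  rewrite (l2_finE (l2_valP g)) -!EFinM -EFinD lee_fin mulrDl mul1r lerD2r.
  by rewrite ler_wpM2r ?fine_ge0 ?norm2_ge0// le_max lexx.
have Bsum (s : seq (seq nat)) (c : seq nat -> R[i]) :
    B (\sum_(al <- s) c al *: ldelta _ al) = 0.
  elim: s => [|al s IH]; first by rewrite big_nil.
  by rewrite big_cons linB IH addr0 /B Adelta subrr scaler0.
apply: val_inj; apply: (@norm2_eq0 _ _ (word_weight R p)).
apply/eqP; rewrite eq_le norm2_ge0 andbT; apply/lee_addgt0Pr => e e0; rewrite add0e.
have K0 : 0 < Num.max M 0 + 1 by rewrite ltr_wpDl// le_max lexx orbT.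
have [s fs] := l2_tail f (divr_gt0 e0 K0).
set g : fock R q := \sum_(j <- s) f j *: _ in fs.
have -> : A f - fock_emb f = B (f - g).
  rewrite (_ : f - g = (-1) *: g + f); last by rewrite scaleN1r addrC.
  by rewrite linB /g Bsum scaler0 add0r.
apply: (le_trans (BM _)); rewrite muleC -lee_pdivlMr//.
by rewrite ltW.
Qed.

Lemma fock_mapE : fock_map (@T_emb R q p) = fock_emb.
Proof.
apply: xget_unique; first exact: fock_emb_is_fock_map.
exact: fock_map_unique.
Qed.

(** Exchange the sums over the basis and over the words; for each word the inner
    sum is evaluated by Parseval's identity for e_al, as
    <e_al, u_j> = w_q(al) conj(u_j(al)). *)
Lemma Bconst_sqr : (Bconst R q p ^+ 2 =
  \esum_(al in [set: seq nat]) ((twoN al)%:R ^ (- (q - p)) : R)%:E)%E.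
Proof.
rewrite /Bconst /HS_norm fock_mapE.
set u := xget _ _.
have ub : orthonormal_basis u.
  exact: (xgetPex _ (delta_basis (word_weight R q))).
set S := \esum_(al in _) _.
have S0 : (0 <= S)%E.
  by apply: esum_ge0 => i _; rewrite expe_ge0// norm2_ge0.
have -> : ((S `^ 2^-1) ^+ 2 = S)%E.
  case: S S0 => [r||] //.
    rewrite lee_fin => r0; rewrite poweR_EFin powR12_sqrt// -EFin_expe.
    by rewrite sqr_sqrtr.
  by move=> _; rewrite poweRyr ?expe2 ?mulyy// gt_eqF// invr_gt0.
have p0 al : (0 <= word_weight R p al) by exact: w_ge0.
rewrite /S; under eq_esum do rewrite norm2K//.
rewrite /sqnorm exchange_esum; last first.
  by move=> i j; rewrite lee_fin mulr_ge0 ?sqr_ge0.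
apply: eq_esum => al _.
under eq_esum do rewrite EFinM.
rewrite esumZl//; last by move=> i; rewrite lee_fin sqr_ge0.
have wq0 : 0 < word_weight R q al by exact: weight_gt0.
have := parseval ub (ldelta _ al); rewrite sqnorm_delta.
under eq_esum do rewrite dot_delta cabsM cabs_conj cabs_real exprMn EFinM.
rewrite esumZl ?sqr_ge0//; last by move=> i; rewrite lee_fin sqr_ge0.
rewrite ger0_norm ?ltW//.
set X := esum _ _; have : (0 <= X)%E by apply: esum_ge0 => i _; rewrite lee_fin sqr_ge0.
case: X => [x| |]//; last first.
  by move=> _; rewrite gt0_muley// lte_fin exprn_gt0.
rewrite lee_fin => x0; rewrite -!EFinM => -[] e; congr EFin.
have -> : x = (word_weight R q al)^-1.
  apply: (mulfI (lt0r_neq0 wq0)); rewrite mulfV ?gt_eqF//.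
  by apply: (mulfI (lt0r_neq0 wq0)); rewrite mulrA mulr1 -expr2.
rewrite /= invr_expz -expfzDr ?pnatr_eq0 ?gtn_eqF ?twoN_gt0//.
by rewrite opprB.
Qed.

End fock_map_inclusion.

(** * Bounds for the Wick product *)

Section cauchy_schwarz.
Context {R : realType}.

(** Converse of the arithmetic-geometric inequality: the right-hand side is
    minimal at t = sqrt (B / A), and t = x / A is good enough.  Together with
    [amgm_of_sqr] it reduces Cauchy-Schwarz, for finite or infinite sums, to the
    additivity and monotonicity of the sum. *)
Lemma sqr_le_of_amgm (x A B : R) : 0 <= x -> 0 <= A -> 0 <= B ->
  (forall t, 0 < t -> 2 * x <= t * A + t^-1 * B) -> x ^+ 2 <= A * B.
Proof.
move=> x0 A0 B0 h; have [->|xn0] := eqVneq x 0.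
  by rewrite expr0n mulr_ge0.
have {xn0}x0 : 0 < x by rewrite lt_neqAle eq_sym xn0.
have [AE|An0] := eqVneq A 0.
  have t0 : 0 < (B + 1) / x by rewrite divr_gt0// ltr_wpDl.
  have := h _ t0; rewrite AE mulr0 add0r mul0r leNgt => /negP[].
  have B1 : 0 < B + 1 by rewrite ltr_wpDl.
  rewrite invf_div mulrAC ltr_pdivrMr// -subr_gt0.
  rewrite (_ : _ - _ = x * (B + 2)); last by ring.
  by rewrite mulr_gt0// ltr_wpDl.
have {An0}A0 : 0 < A by rewrite lt_neqAle eq_sym An0.
have := h _ (divr_gt0 x0 A0).
rewrite divfK ?gt_eqF// (_ : 2 * x = x + x); last by ring.
by rewrite lerD2l invf_div mulrAC ler_pdivlMr// expr2.
Qed.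

Lemma amgm_of_sqr (x a b t : R) : 0 <= a -> 0 <= b -> 0 < t -> x ^+ 2 <= a * b ->
  2 * x <= t * a + t^-1 * b.
Proof.
move=> a0 b0 t0 xab; rewrite (le_trans (ler_norm _))//.
have ti0 : 0 < t^-1 by rewrite invr_gt0.
rewrite -ler_sqr ?nnegrE// ?addr_ge0 ?mulr_ge0 ?(ltW t0) ?(ltW ti0)//.
rewrite real_normK ?num_real//.
apply: (@le_trans _ _ (4 * (a * b))).
  rewrite (_ : (2 * x) ^+ 2 = 4 * x ^+ 2); last by ring.
  by rewrite ler_wpM2l.
rewrite -subr_ge0 (_ : _ - _ = (t * a - t^-1 * b) ^+ 2) ?sqr_ge0//.
by field; rewrite gt_eqF.
Qed.

Lemma sum_cauchy_schwarz (I : finType) (x a b : I -> R) :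
  (forall i, 0 <= x i) -> (forall i, 0 <= a i) -> (forall i, 0 <= b i) ->
  (forall i, x i ^+ 2 <= a i * b i) ->
  (\sum_i x i) ^+ 2 <= (\sum_i a i) * (\sum_i b i).
Proof.
move=> x0 a0 b0 h; apply: sqr_le_of_amgm; try by apply: sumr_ge0.
move=> t t0; rewrite !mulr_sumr -big_split /=; apply: ler_sum => i _.
exact: amgm_of_sqr.
Qed.

Lemma esum_cauchy_schwarz (I : choiceType) (x a b : I -> R) (A B : R) :
  (forall i, 0 <= x i) -> (forall i, 0 <= a i) -> (forall i, 0 <= b i) ->
  (forall i, x i ^+ 2 <= a i * b i) ->
  (\esum_(i in [set: I]) (a i)%:E = A%:E)%E ->
  (\esum_(i in [set: I]) (b i)%:E = B%:E)%E ->
  exists2 X : R, (\esum_(i in [set: I]) (x i)%:E = X%:E)%E &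
    0 <= X /\ X ^+ 2 <= A * B.
Proof.
move=> x0 a0 b0 h aA bB.
have A0 : 0 <= A by rewrite -lee_fin -aA; apply: esum_ge0 => i _; rewrite lee_fin.
have B0 : 0 <= B by rewrite -lee_fin -bB; apply: esum_ge0 => i _; rewrite lee_fin.
have S0 : (0 <= \esum_(i in [set: I]) (x i)%:E)%E.
  by apply: esum_ge0 => i _; rewrite lee_fin.
have le (t : R) : 0 < t ->
    (2%:E * (\esum_(i in [set: I]) (x i)%:E) <= (t * A + t^-1 * B)%:E)%E.
  move=> t0; have ti0 : 0 < t^-1 by rewrite invr_gt0.
  rewrite (EFinD (t * A)) !EFinM -aA -bB -!esumZl ?(ltW t0) ?(ltW ti0)//.
  rewrite -esumD; try by move=> i _; rewrite lee_fin mulr_ge0// ltW.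
  apply: le_esum => i _; rewrite -!EFinM -EFinD lee_fin.
  exact: amgm_of_sqr.
have Sfin : (\esum_(i in [set: I]) (x i)%:E)%E \is a fin_num.
  (* t = 1 already bounds the sum. *)
  rewrite ge0_fin_numE//; apply: le_lt_trans (_ : _ <= (A + B)%:E)%E _.
    have := le _ ltr01; rewrite invr1 !mul1r; apply: le_trans.
    by rewrite lee_pemull// lee_fin ler1n.
  by rewrite ltry.
exists (fine (\esum_(i in [set: I]) (x i)%:E)); first by rewrite fineK.
split; first exact: fine_ge0.
apply: sqr_le_of_amgm => //; first exact: fine_ge0.
by move=> t t0; rewrite -lee_fin EFinM fineK// le.
Qed.

End cauchy_schwarz.

Section splittings.
Context {R : realType}.
Local Open Scope ereal_scope.

Lemma sum_inj_le_esum (I : choiceType) n (e : 'I_n -> I) (a : I -> \bar R) :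
  injective e -> (forall i, 0 <= a i) ->
  \sum_(k < n) a (e k) <= \esum_(i in [set: I]) a i.
Proof.
move=> inj a0; pose s := [seq e k | k <- enum 'I_n].
apply: esum_ge; exists [set` s]; first by split => //; exact: finite_seq.
rewrite -fsbig_seq; last by rewrite map_inj_uniq// enum_uniq.
by rewrite big_map big_enum.
Qed.

(** The pairs of a word and a cutting position correspond to the pairs of words,
    by concatenation. *)
Lemma esum_splits (a : seq nat -> seq nat -> \bar R) : (forall x y, 0 <= a x y) ->
  \esum_(ga in [set: seq nat]) \sum_(k < (size ga).+1) a (take k ga) (drop k ga)
  = \esum_(al in [set: seq nat]) \esum_(be in [set: seq nat]) a al be.
Proof.
move=> a0; pose J (ga : seq nat) : set nat := `I_(size ga).+1.
transitivity (\esum_(ga in [set: seq nat]) \esum_(k in J ga)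
    a (take k ga) (drop k ga)).
  apply: eq_esum => ga _; rewrite -[J ga]set_mem_set esum_fset//; last first.
    by rewrite set_mem_set; exact: finite_II.
  rewrite set_mem_set /J.
  exact: (fsbig_ord _ (size ga).+1 (fun k => a (take k ga) (drop k ga))).
rewrite esum_esum// -(esum_pair (a := fun k => a k.1 k.2))//.
rewrite (@reindex_esum _ _ _ setT _ (fun k => (k.1 ++ k.2, size k.1))).
  apply: eq_esum => -[al be] _ /=; rewrite take_size_cat// drop_size_cat//.
split.
- by move=> [al be] _; split => //=; rewrite /J /= size_cat ltnS leq_addr.
- move=> [al be] [al' be'] _ _ /= [e s].
  by move/eqP: e; rewrite eqseq_cat// => /andP[/eqP -> /eqP ->].
- move=> [ga k] [_ /=]; rewrite /J /= ltnS => kga.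
  by exists (take k ga, drop k ga) => //=; rewrite cat_take_drop size_takel.
Qed.

End splittings.

Section wick_bound.
Context {R : realType}.

Lemma twoN_cat al be : twoN (al ++ be) = (twoN al * twoN be)%N.
Proof. by rewrite /twoN big_cat. Qed.

(** Young's inequality for the convolution on the free monoid, l and r giving the
    two factors of the k-th splitting of a word; the two orders of the Wick product
    only differ by exchanging l and r.  With F = |f| (2N)^(- q / 2) and
    G = |g| (2N)^(- q / 2), Cauchy-Schwarz gives
    (sum_k F G)^2 <= (sum_k F) (sum_k F G^2).  The first factor is at most
    X = sum F, since the words l k ga are distinct for distinct k, and the sum over
    all words ga of the second one is X ||g||^2. *)
Lemma conv_sqnorm_le (l r : nat -> seq nat -> seq nat) (p q : int) (S : R)
    (f : fock R (- p)) (g : fock R (- q)) :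
  (forall ga k, (k <= size ga)%N -> twoN (l k ga) * twoN (r k ga) = twoN ga)%N ->
  (forall ga, injective (fun k : 'I_(size ga).+1 => l k ga)) ->
  (forall a : seq nat -> seq nat -> \bar R, (forall x y, 0 <= a x y)%E ->
    \esum_(ga in [set: seq nat]) \sum_(k < (size ga).+1) a (l k ga) (r k ga)
    = \esum_(al in [set: seq nat]) \esum_(be in [set: seq nat]) a al be)%E ->
  (\esum_(al in [set: seq nat]) ((twoN al)%:R ^ (- (q - p)) : R)%:E = S%:E)%E ->
  (sqnorm (word_weight R (- q))
     (fun ga => (\sum_(k < (size ga).+1) f (l k ga) * g (r k ga))%R)
   <= S%:E * sqnorm (word_weight R (- p)) f * sqnorm (word_weight R (- q)) g)%E.
Proof.
move=> twoNlr inj_l splits SE.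
have [A fA A0] := sqnorm_fin f; have [C gC C0] := sqnorm_fin g.
pose W al : R := (twoN al)%:R ^ (- q).
have W0 al : 0 <= W al by rewrite exprz_ge0.
pose v al := Num.sqrt (W al).
have v2 al : v al ^+ 2 = W al by rewrite sqr_sqrtr.
pose F al := cabs (f al) * v al; pose G al := cabs (g al) * v al.
have F0 al : 0 <= F al by rewrite mulr_ge0 ?cabs_ge0 ?sqrtr_ge0.
have G0 al : 0 <= G al by rewrite mulr_ge0 ?cabs_ge0 ?sqrtr_ge0.
have [X FX [X0 XSA]] : exists2 X : R,
    (\esum_(al in [set: seq nat]) (F al)%:E = X%:E)%E & 0 <= X /\ X ^+ 2 <= S * A.
  apply: (esum_cauchy_schwarz _ _ _ _ SE fA) => // al.
  - by rewrite exprz_ge0.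
  - by rewrite mulr_ge0 ?sqr_ge0//= exprz_ge0.
  - rewrite /F exprMn v2 mulrA /= -expfzDr ?pnatr_eq0 ?gtn_eqF ?twoN_gt0//.
    rewrite mulrC /W (_ : - (q - p) - p = - q) //; ring.
have G2C : (\esum_(be in [set: seq nat]) (G be ^+ 2)%:E = C%:E)%E.
  by rewrite -gC; apply: eq_esum => be _; rewrite /G exprMn v2 mulrC.
rewrite fA gC; apply: (@le_trans _ _ (\esum_(ga in [set: seq nat])
    (X%:E * \sum_(k < (size ga).+1) (F (l k ga) * G (r k ga) ^+ 2)%:E)))%E.
  apply: le_esum => ga _; rewrite sumEFin -EFinM lee_fin.
  apply: (@le_trans _ _ ((\sum_(k < (size ga).+1) F (l k ga) * G (r k ga)) ^+ 2)).
    rewrite -[word_weight _ _ ga]/(W ga) -v2 -exprMn ler_sqr ?nnegrE ?mulr_ge0 ?sqrtr_ge0 ?cabs_ge0//; last first.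
      by apply: sumr_ge0 => k _; rewrite mulr_ge0.
    apply: (@le_trans _ _ (v ga * \sum_(k < (size ga).+1)
        cabs (f (l k ga) * g (r k ga)))).
      rewrite ler_wpM2l ?sqrtr_ge0// -lecR -Defs.normcE rmorph_sum /=.
      by apply: (le_trans (ler_norm_sum _ _ _)).
    rewrite mulr_sumr; apply: ler_sum => k _.
    have -> : v ga = v (l k ga) * v (r k ga).
      rewrite /v -sqrtrM// /W -expfzMl -natrM twoNlr//.
      by rewrite -ltnS.
    rewrite cabsM -subr_ge0 (_ : _ - _ = 0) //; rewrite /F /G; ring.
  apply: (@le_trans _ _ ((\sum_(k < (size ga).+1) F (l k ga)) *
     (\sum_(k < (size ga).+1) F (l k ga) * G (r k ga) ^+ 2))).
    apply: sum_cauchy_schwarz => k //; first by rewrite mulr_ge0.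
      by rewrite mulr_ge0 ?sqr_ge0.
    by rewrite exprMn expr2 mulrA.
  rewrite ler_wpM2r//; first by apply: sumr_ge0 => k _; rewrite mulr_ge0 ?sqr_ge0.
  rewrite -lee_fin -FX -sumEFin.
  exact: (@sum_inj_le_esum _ _ _ (fun k : 'I_(size ga).+1 => l k ga)
    (fun al => (F al)%:E)).
rewrite esumZl// => [|ga]; last first.
  by rewrite sume_ge0// => k _; rewrite lee_fin mulr_ge0 ?sqr_ge0.
rewrite (splits (fun al be => (F al * G be ^+ 2)%:E)); last first.
  by move=> x y; rewrite lee_fin mulr_ge0 ?sqr_ge0.
rewrite (_ : esum _ _ = C%:E * X%:E)%E; last first.
  rewrite -FX -esumZl//; apply: eq_esum => al _.
  rewrite muleC -G2C -esumZl//.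
  by move=> be; rewrite lee_fin sqr_ge0.
rewrite -!EFinM lee_fin mulrCA -expr2 mulrC.
by rewrite ler_wpM2r.
Qed.

Lemma wick_sqnorm_le (p q : int) (S : R) (f : fock R (- p)) (g : fock R (- q)) :
  (\esum_(al in [set: seq nat]) ((twoN al)%:R ^ (- (q - p)) : R)%:E = S%:E)%E ->
  (sqnorm (word_weight R (- q)) (wick f g)
   <= S%:E * sqnorm (word_weight R (- p)) f * sqnorm (word_weight R (- q)) g)%E.
Proof.
apply: (@conv_sqnorm_le (fun k => take k) (fun k => drop k)).
- by move=> ga k _; rewrite -twoN_cat cat_take_drop.
- move=> ga j k /(congr1 size); rewrite !size_takel -1?ltnS//.
  exact: ord_inj.
- exact: esum_splits.
Qed.

Lemma wick_sqnorm_le_sym (p q : int) (S : R) (f : fock R (- p)) (g : fock R (- q)) :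
  (\esum_(al in [set: seq nat]) ((twoN al)%:R ^ (- (q - p)) : R)%:E = S%:E)%E ->
  (sqnorm (word_weight R (- q)) (wick g f)
   <= S%:E * sqnorm (word_weight R (- p)) f * sqnorm (word_weight R (- q)) g)%E.
Proof.
move=> SE; have -> : wick g f = fun ga =>
    \sum_(k < (size ga).+1) f (drop k ga) * g (take k ga).
  by apply/funext => ga; apply: eq_bigr => k _; rewrite mulrC.
apply: (@conv_sqnorm_le (fun k => drop k) (fun k => take k)) => //.
- by move=> ga k _; rewrite mulnC -twoN_cat cat_take_drop.
- move=> ga j k /(congr1 size); rewrite !size_drop => e.
  apply: ord_inj; rewrite -[LHS](subKn (_ : (j <= size ga)%N)) -1?ltnS//.
  by rewrite e subKn// -ltnS.
- move=> a a0; rewrite exchange_esum//.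
  by rewrite -(esum_splits (a := fun al be => a be al)).
Qed.

End wick_bound.

Section wick_norm.
Context {R : realType}.
Local Open Scope ereal_scope.

Lemma norm_le_of_sqnorm (p q : int) (S B : \bar R) (f : fock R (- p))
    (g : fock R (- q)) (h : seq nat -> R[i]) : 0 <= B -> B ^+ 2 = S ->
  sqnorm (word_weight R (- q)) h
    <= S * sqnorm (word_weight R (- p)) f * sqnorm (word_weight R (- q)) g ->
  fock_norm q h <= B * fock_norm p f * fock_norm q g.
Proof.
move=> B0 BS hS.
have n0 r k : 0 <= fock_norm (R := R) r k by exact: norm2_ge0.
rewrite -lee_sqr ?mule_ge0 ?n0//.
rewrite expe2 [leRHS]expe2 muleACA (muleACA B) -!expe2 BS.
by rewrite !norm2K// => i; exact: w_ge0.
Qed.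

End wick_norm.

(** * Seminorms and nuclearity from coordinates *)

Section seminorm_facts.
Context {R : realType} {E : lmodType R[i]} {p : E -> R} (pP : is_seminorm p).

Lemma seminorm0 : p 0 = 0.
Proof. by rewrite -(scale0r (0 : E)) pP.2 cabs0 mul0r. Qed.

Lemma seminormN x : p (- x) = p x.
Proof. by rewrite -scaleN1r pP.2 cabsN (cabs_delta true) mul1r. Qed.

Lemma seminorm_ge0 x : 0 <= p x.
Proof.
have := pP.1 x (- x); rewrite subrr seminorm0 seminormN => h; lra.
Qed.

Lemma seminormB_le x y : `|p x - p y| <= p (x - y).
Proof.
rewrite ler_norml lerBlDr lerNl opprB lerBlDr; apply/andP; split.
  by have := pP.1 (y - x) x; rewrite subrK -[p (y - x)]seminormN opprB.
by have := pP.1 (x - y) y; rewrite subrK.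
Qed.

End seminorm_facts.

Section locally_convex.
Context {R : realType} {E : lmodType R[i]} (P : seminorm_family E).

Lemma lctvs_hausdorff :
  (forall x : E, x != 0 -> exists i, 0 < sf_val (s := P) i x) ->
  hausdorff_space (lctvs P).
Proof.
move=> sep x y xy; apply/eqP; apply: contrapT => /negP yx.
have yx0 : (y : E) - x != 0 by rewrite subr_eq0 eq_sym.
have [ i ] := sep _ yx0.
set d := sf_val i _ => d0.
have nb (z : lctvs P) : nbhs z [set t : lctvs P | sf_max [:: i] (t - z) < d / 2].
  by exists [:: i], (d / 2) => //; rewrite divr_gt0.
have [t []] := xy _ _ (nb x) (nb y).
have le z : sf_val i z <= sf_max [:: i] z.
  by rewrite /sf_max big_cons le_max lexx.
rewrite /mkset => tx ty; suff : d < d by rewrite ltxx.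
have := (sf_valP (s := P) i).1 (y - t) (t - x).
rewrite addrA subrK -/d => /le_lt_trans; apply.
rewrite [ltRHS]splitr ltrD//; last exact: le_lt_trans (le _) tx.
rewrite -(seminormN (sf_valP i)) opprB; exact: le_lt_trans (le _) ty.
Qed.

(** The unit ball of p contains a ball of radius e of some sf_max s; scaling x to
    norm about e / 2 gives p <= (2 / e) sf_max s.  The scaling factor is
    e / (2 (M + d)) with d > 0 arbitrary, since M = sf_max s x may vanish. *)
Lemma continuous_seminorm_le (p : lctvs P -> R) : is_seminorm p -> continuous p ->
  exists s : seq (sf_index P), exists2 C : R, 0 < C &
    forall x : E, p x <= C * sf_max s x.
Proof.
move=> pP pc.
have /cvgrPdist_lt/(_ 1 ltr01) := pc 0.
move=> [s [e e0 sp]]; exists s, (2 / e); first by rewrite divr_gt0.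
move=> x; apply/ler_addgt0Pr => c c0.
set M := sf_max s x; have M0 : 0 <= M by exact: sf_max_ge0.
pose d := e / 2 * c; have d0 : 0 < d by rewrite mulr_gt0// divr_gt0.
have Md : 0 < M + d by rewrite ltr_wpDl.
pose k := e / 2 / (M + d); have k0 : 0 < k by rewrite !divr_gt0.
have := sp (k%:C *: x); rewrite /mkset subr0 sf_maxZ cabs_real gtr0_norm//.
have kM : k * sf_max s x < e.
  rewrite -/M /k mulrAC ltr_pdivrMr//.
  rewrite (@le_lt_trans _ _ (e / 2 * (M + d)))//.
    by rewrite ler_wpM2l ?divr_ge0 ?(ltW e0)// lerDl ltW.
  by rewrite ltr_pM2r//; rewrite ltr_pdivrMr// ltr_pMr// ltr1n.
move=> /(_ kM); rewrite (seminorm0 pP) sub0r normrN pP.2 cabs_real.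
rewrite (gtr0_norm k0) => h.
have {}h : k * p x < 1 by exact: le_lt_trans (ler_norm _) h.
have : p x < k^-1 by rewrite -[k^-1]mul1r ltr_pdivlMr// mulrC.
have -> : k^-1 = 2 / e * M + c.
  rewrite /k /d; field; rewrite !gt_eqF//= ltr_wpDl ?mulr_ge0 ?mulr_gt0//.
exact: ltW.
Qed.

Lemma seminorm_continuous (p : lctvs P -> R) (i : sf_index P) (C : R) : is_seminorm p -> 0 <= C ->
  (forall x : E, p x <= C * sf_val i x) -> continuous p.
Proof.
move=> pP C0 pC x U /nbhs_ballP[e /= e0 eU].
have C1 : 0 < C + 1 by rewrite ltr_wpDl.
exists [:: i], (e / (C + 1)); first by rewrite divr_gt0.
move=> y /=; rewrite /sf_max big_cons gt_max => /andP[yx _].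
apply: eU; rewrite -ball_normE /ball_ /= distrC (le_lt_trans (seminormB_le pP _ _))// (le_lt_trans (pC _))//.
rewrite (@le_lt_trans _ _ ((C + 1) * sf_val i (y - x)))//.
  by rewrite ler_wpM2r ?lerDl// (seminorm_ge0 (sf_valP i)).
by rewrite mulrC -ltr_pdivlMr.
Qed.

Lemma seminormZ (p : E -> R) (C : R) : 0 <= C -> is_seminorm p ->
  is_seminorm (fun x => C * p x).
Proof.
move=> C0 pP; split=> [x y|a x]; first by rewrite -mulrDr ler_wpM2l// pP.1.
by rewrite pP.2 mulrCA.
Qed.

End locally_convex.

(** The expansion x = sum_i coord x i *: e i has to be indexed by nat: I is
    enumerated by pickle_inv, which takes the value None outside the range of the
    injection pickle; the corresponding terms of the expansion vanish.  If a i = 0,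
    then (a i)^-1 = 0 and the i-th term vanishes as well, harmlessly since p does
    not see that coordinate. *)
Section coordinates.
Context {R : realType} {I : countType} (E : tvsType R[i]).
Variables (coord : E -> I -> R[i]) (e : I -> E).
Hypothesis coordP : forall (k : R[i]) x y i,
  coord (k *: x + y) i = k * coord x i + coord y i.
Hypothesis coord_e : forall i, coord (e i) = delta i.
Variables (a d : I -> R).
Hypothesis a0 : forall i, 0 <= a i.
Hypothesis d0 : forall i, 0 < d i.

Definition opt_coef (o : option I) : R[i] := if o is Some i then (d i)%:C else 0.

Definition opt_form (o : option I) (x : E) : R[i]^o :=
  if o is Some i then (a i / d i)%:C * coord x i else 0.

Definition opt_vec (o : option I) : E := if o is Some i then ((a i)^-1)%:C *: e i else 0.

Lemma opt_form_linear o : linear (opt_form o).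
Proof.
case: o => [i|] k x y /=; last by rewrite scaler0 addr0.
by rewrite coordP mulrDr /GRing.scale /= mulrCA.
Qed.

HB.instance Definition _ o := GRing.isLinear.Build R[i] E R[i]^o _ (opt_form o)
  (opt_form_linear o).

Let coord0 i : coord 0 i = 0.
Proof.
have := coordP (-1) 0 0 i; rewrite scaler0 addr0 mulN1r => ->.
by rewrite addNr.
Qed.

Let coordD x y i : coord (x + y) i = coord x i + coord y i.
Proof. by rewrite -[x]scale1r coordP mul1r scale1r. Qed.

Let coordZ k x i : coord (k *: x) i = k * coord x i.
Proof. by rewrite -[k *: x]addr0 coordP coord0 addr0. Qed.

Let pick (n : nat) : option I := pickle_inv n.

Let psum x N : E := \sum_(n < N) (opt_coef (pick n) * opt_form (pick n) x) *: opt_vec (pick n).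

Let coord_term x (n : nat) j :
  coord ((opt_coef (pick n) * opt_form (pick n) x) *: opt_vec (pick n)) j
    = if n == choice.pickle j then (a j / a j)%:C * coord x j else 0.
Proof.
rewrite coordZ /pick; have := @pickle_invK I n.
case nE: (pickle_inv n) => [i|] /= h; last first.
  by rewrite mul0r mul0r; case: eqP => // nj; rewrite nj pickleK_inv in nE.
rewrite coordZ coord_e /delta -h (inj_eq (pcan_inj pickleK_inv)) eq_sym.
case: eqVneq => [->|_]; last by rewrite !mulr0.
rewrite mulr1 mulrA -complexRM mulrAC -complexRM.
by rewrite [d j * _]mulrC divfK// gt_eqF.
Qed.

Let coord_psum x N j : coord (psum x N) j
  = if (choice.pickle j < N)%N then (a j / a j)%:C * coord x j else 0.
Proof.
elim: N => [|N IH]; first by rewrite /psum big_ord0 coord0.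
rewrite /psum big_ord_recr coordD -/(psum x N) IH coord_term ltnS (leq_eqVlt (choice.pickle j) N).
rewrite (eq_sym N); case: (ltngtP (choice.pickle j) N) => //= _.
- by rewrite addr0.
- by rewrite addr0.
- by rewrite add0r.
Qed.

(** Subtracting psum x N cancels the first N coordinates, except for those that are
    weighted by a j = 0. *)
Let coord_tail x N j : a j * cabs (coord (x - psum x N) j) <=
  if (choice.pickle j < N)%N then 0 else a j * cabs (coord x j).
Proof.
rewrite -scaleN1r addrC coordP mulN1r coord_psum.
case: ltnP => _; last by rewrite oppr0 add0r.
have [->|aj] := eqVneq (a j) 0; first by rewrite mul0r.
by rewrite divff// mul1r addNr cabs0 mulr0.
Qed.

Hypothesis d_summable : (\esum_(i in [set: I]) (d i)%:E < +oo)%E.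

Let g (n : nat) : R := if pick n is Some i then d i else 0.

Let g0 n : 0 <= g n.
Proof. by rewrite /g; case: (pick n) => // i; exact/ltW. Qed.

Let g_pickle (i : I) : g (choice.pickle i) = d i.
Proof. by rewrite /g /pick pickleK_inv. Qed.

Let g_out n : (forall i : I, choice.pickle i <> n) -> g n = 0.
Proof.
rewrite /g /pick; have := @pickle_invK I n.
by case: pickle_inv => //= i h /(_ i).
Qed.

Let esum_pickle (F : nat -> \bar R) : (forall n, g n = 0 -> F n = 0%E) ->
  (\esum_(n in [set: nat]) F n = \esum_(i in [set: I]) F (choice.pickle i))%E.
Proof.
move=> F0; transitivity (\esum_(n in (@choice.pickle I) @` setT) F n)%E.
  rewrite [RHS]esum_mkcond; apply: eq_esum => n _.
  case: ifPn => // /negP; rewrite inE /= => nn.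
  by rewrite F0// g_out// => i h; apply: nn; exists i.
by rewrite esum_image// => i j _ _; exact: (pcan_inj pickleK_inv).
Qed.

Let esum_g : (\esum_(n in [set: nat]) (g n)%:E = \esum_(i in [set: I]) (d i)%:E)%E.
Proof.
rewrite esum_pickle => [|n -> //].
by apply: eq_esum => i _; rewrite g_pickle.
Qed.

Let series_g N : (series g N)%:E = (\sum_(n \in `I_N) (g n)%:E)%E.
Proof. by rewrite /series /= big_mkord -sumEFin (fsbig_ord _ N (fun n => (g n)%:E)). Qed.

Let g_cvg : cvgn (series g).
Proof.
apply: nondecreasing_is_cvgn.
  apply/nondecreasing_seqP => n; rewrite /series /= big_nat_recr //=.
  by rewrite lerDl.
exists (fine (\esum_(i in [set: I]) (d i)%:E)) => _ [n _ <-].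
rewrite -lee_fin fineK; last first.
  by rewrite ge0_fin_numE// esum_ge0// => i _; rewrite lee_fin ltW.
rewrite -esum_g series_g; by apply: esum_ge; exists `I_n.
Qed.

Let esum_tail (N : nat) :
  (\esum_(i in [set: I]) (if (choice.pickle i < N)%N then 0 else d i)%:E
    = (limn (series g) - series g N)%:E)%E.
Proof.
have L : ((limn (series g))%:E = \esum_(n in [set: nat]) (g n)%:E)%E.
  rewrite -nneseries_esumT; last by move=> n; rewrite lee_fin.
  rewrite -EFin_lim//; congr (limn _); apply/funext => n /=.
  by rewrite /series /= sumEFin.
transitivity (\esum_(n in [set: nat]) (if (n < N)%N then 0 else g n)%:E)%E.
  rewrite esum_pickle; last by move=> n gn; case: ltnP => // _; rewrite gn.
  by apply: eq_esum => i _; rewrite g_pickle.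
rewrite EFinB L (@esumID _ _ `I_N setT (fun n => (g n)%:E)) => [|n _]; last by rewrite lee_fin.
have -> : (\esum_(n in setT `&` `I_N) (g n)%:E = (series g N)%:E)%E.
  rewrite setTI series_g -{1}(set_mem_set `I_N) esum_fset ?set_mem_set//.
  by move=> n _; rewrite lee_fin.
rewrite setTI [(_%:E + _)%E]addeC addeK//.
rewrite [RHS]esum_mkcond; apply: eq_esum => n _.
case: (ltnP n N) => nN; first by rewrite memNset// => /(_ nN).
by rewrite mem_set//= => nN'; move: nN; rewrite leqNgt nN'.
Qed.

Variables (p : E -> R).
Hypothesis pP : is_seminorm p.
Hypothesis p_le : forall x, ((p x)%:E <= \esum_(i in [set: I]) (a i * cabs (coord x i))%:E)%E.

(** Convergence: p (x - psum x N) is at most the sum of a_i |x_i| over the indices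
    beyond N, hence at most q x times a tail of the convergent series of d. *)
Lemma coordinates_nuclear :
  (exists q : E -> R, [/\ is_seminorm q, continuous q &
     forall x i, a i * cabs (coord x i) <= d i * q x]) ->
  nuclear_canonical_map p.
Proof.
move=> [q [qP qc qa]].
exists (fun n => opt_coef (pick n)), (fun n => opt_form (pick n)),
  (fun n _ => opt_vec (pick n)); split.
- suff -> : (fun n => cabs (opt_coef (pick n))) = g by exact: g_cvg.
  apply/funext => n; rewrite /g; case: (pick n) => [i|]; last by rewrite /opt_coef cabs0.
  by rewrite cabs_real gtr0_norm.
- exists q; split => // n x; case: (pick n) => [i|]; rewrite /opt_form; last first.
    have -> : cabs (0 : R[i]^o) = 0 by exact: cabs0. exact: seminorm_ge0.
  rewrite cabsM cabs_real ger0_norm; last by rewrite divr_ge0// ltW.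
  rewrite mulrAC.
  by rewrite ler_pdivrMr// [leRHS]mulrC qa.
- move=> n; split.
    by move=> r r0; exists 0 => ? ? _ _; rewrite subrr (seminorm0 pP).
  rewrite /completion_norm lim_cst//=; case: (pick n) => [i|] /=; last first.
    by rewrite (seminorm0 pP).
  rewrite pP.2 cabs_real ger0_norm ?invr_ge0//.
  have : p (e i) <= a i.
    rewrite -lee_fin (le_trans (p_le _))// (esum_single (i := i)).
    - by rewrite coord_e /delta eqxx cabs_delta mulr1.
    - by rewrite lee_fin mulr_ge0 ?cabs_ge0.
    - by move=> j ji; rewrite coord_e /delta (negbTE ji) cabs_delta mulr0.
  have [->|ai] := eqVneq (a i) 0; first by rewrite invr0 mul0r.
  by rewrite ler_pdivrMl ?mulr1// lt_neqAle eq_sym ai a0.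
- move=> x.
  pose T N : R := q x * (limn (series g) - series g N).
  have T0 : T @ \oo --> (0 : R).
    rewrite -[0](mulr0 (q x)); apply: cvgMr.
    rewrite -[0](subrr (limn (series g))); apply: cvgB; [exact: cvg_cst|exact: g_cvg].
  apply: (@squeeze_cvgr _ _ _ _ (cst 0) T) => //; last exact: cvg_cst.
  apply: nearW => N; rewrite /completion_norm.
  have -> : (fun m : nat => x - \sum_(n < N) (opt_coef (pick n) * opt_form (pick n) x)
      *: opt_vec (pick n)) = fun=> x - psum x N by [].
  rewrite lim_cst// (seminorm_ge0 pP) /= -lee_fin (le_trans (p_le _))//.
  rewrite /T EFinM -esum_tail -esumZl ?(seminorm_ge0 qP)//; last first.
    by move=> i; rewrite lee_fin; case: ifP => // _; exact: ltW.
  apply: le_esum => i _; rewrite -EFinM lee_fin (le_trans (coord_tail _ _ _))//.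
  by case: ifP => _; rewrite ?mulr0// [leRHS]mulrC qa.
Qed.

End coordinates.

(** * The two Kondratiev spaces *)

Section l1_l2.
Context {R : realType} {I : choiceType} (w : weight R I).

(** With X the sum on the right, each term v_i |f_i| is at most X, so that their
    squares add up to at most X X. *)
Lemma norm2_le_esum (v : I -> R) (f : I -> R[i]) : (forall i, 0 <= v i) ->
  (forall i, w i <= v i ^+ 2) ->
  (norm2 w f <= \esum_(i in [set: I]) (v i * cabs (f i))%:E)%E.
Proof.
move=> v0 wv; set X := esum _ _.
have t0 i : 0 <= v i * cabs (f i) by rewrite mulr_ge0 ?cabs_ge0.
have X0 : (0 <= X)%E by apply: esum_ge0 => i _; rewrite lee_fin.
have [Xoo|] := eqVneq X +oo%E; first by rewrite Xoo leey.
rewrite -ltey => Xfin.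
have XE : X = (fine X)%:E by rewrite fineK// ge0_fin_numE.
have term i : v i * cabs (f i) <= fine X.
  rewrite -lee_fin -XE; apply: (esum_ge_term (a := fun i => (v i * cabs (f i))%:E)).
  by move=> j; rewrite lee_fin.
have : (norm2 w f ^+ 2 <= X ^+ 2)%E.
  rewrite norm2K; last exact: w_ge0.
  rewrite expe2 {1}XE -esumZl ?fine_ge0//.
  apply: le_esum => i _; rewrite -EFinM lee_fin.
  apply: (@le_trans _ _ ((v i * cabs (f i)) * (v i * cabs (f i)))).
    by rewrite -expr2 exprMn ler_wpM2r ?sqr_ge0.
  by rewrite ler_wpM2r.
by rewrite lee_sqr ?norm2_ge0.
Qed.

Lemma coord_le_norm2 (f : I -> R[i]) i (v : R) : f \in l2_pred w -> 0 <= v ->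
  v ^+ 2 <= w i -> v * cabs (f i) <= fine (norm2 w f).
Proof.
move=> fw v0 vw.
have n0 : 0 <= fine (norm2 w f) by rewrite fine_ge0 ?norm2_ge0.
rewrite -ler_sqr ?nnegrE ?mulr_ge0 ?cabs_ge0//.
rewrite -lee_fin [leRHS]EFin_expe -l2_finE// norm2K; last exact: w_ge0.
rewrite (nsqE (L2 fw)) lee_fin (le_trans _ (coord_le_nsq (L2 fw) i))//.
by rewrite exprMn ler_wpM2r ?sqr_ge0.
Qed.

End l1_l2.

Section S1_nuclear.
Context {R : realType}.

Lemma twoN_ge1 (al : seq nat) : 1 <= (twoN al)%:R :> R.
Proof. by rewrite ler1n twoN_gt0. Qed.

Definition inv_sqr_twoN (al : seq nat) : R := (twoN al)%:R ^ (- (2 : int)).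

Lemma inv_sqr_twoN_gt0 al : 0 < inv_sqr_twoN al.
Proof. by rewrite exprz_gt0// ltr0n twoN_gt0. Qed.

Lemma inv_sqr_twoNE al : inv_sqr_twoN al = ((twoN al)%:R ^+ 2)^-1. Proof. by []. Qed.

Lemma inv_sqr_twoN_summable : (\esum_(al in [set: seq nat]) (inv_sqr_twoN al)%:E < +oo)%E.
Proof. by rewrite /inv_sqr_twoN twoN_sum// ltry. Qed.

Lemma S1_in (x : S1_space R) (p : nat) : (0 < p)%N ->
  S1_val x \in l2_pred (word_weight R p).
Proof. by have /asboolP := S1_valP x; apply. Qed.

Lemma S1_norm_ge0 i (x : S1_space R) : 0 <= S1_norm i x.
Proof. by rewrite fine_ge0 ?norm2_ge0. Qed.

Lemma twoN_coord_le (k : nat) (x : S1_space R) al (h : (0 < k.*2)%N) :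
  (twoN al)%:R ^+ k * cabs (x al) <= S1_norm (exist _ k.*2 h) x.
Proof.
apply: coord_le_norm2; rewrite ?S1_in ?exprn_ge0//.
by rewrite /= -exprM muln2.
Qed.

(** The l^1 weight is (2N)^(k al) and not its square root, in order to stay with
    integral powers of (2N)^al. *)
Lemma S1_norm_le_esum i (k : nat) (x : S1_space R) : (sval i <= k)%N ->
  ((S1_norm i x)%:E
   <= \esum_(al in [set: seq nat]) ((twoN al)%:R ^+ k * cabs (x al))%:E)%E.
Proof.
move=> ik; rewrite /S1_norm -l2_finE; last by apply: S1_in; exact: svalP i.
apply: norm2_le_esum => al; first by rewrite exprn_ge0.
rewrite /= -exprM; apply: ler_weXn2l; first exact: twoN_ge1.
by rewrite (leq_trans ik)// muln2 -addnn leq_addr.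
Qed.

Lemma delta_S1 (al : seq nat) : delta al \in S1_pred (R := R).
Proof. by apply/asboolP => p _; exact: delta_l2. Qed.

Definition eS1 (al : seq nat) : S1_space R := S1Space (delta_S1 al).

Lemma S1_hausdorff : hausdorff_space (S1 R).
Proof.
apply: lctvs_hausdorff => x x0; exists (exist _ 1%N isT).
rewrite lt_neqAle S1_norm_ge0 andbT eq_sym; apply: contra x0 => /eqP h.
apply/eqP/val_inj/(@norm2_eq0 _ _ (word_weight R 1%N)).
by rewrite l2_finE ?S1_in//; congr EFin.
Qed.

Lemma S1_seq_bound (s : seq {p : nat | (0 < p)%N}) : exists k : nat,
  forall x : S1_space R, ((sf_max (P := S1_norms R) s x)%:E
   <= \esum_(al in [set: seq nat]) ((twoN al)%:R ^+ k * cabs (x al))%:E)%E.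
Proof.
exists (\max_(i <- s) sval i)%N => x.
have E0 k : (0 <= \esum_(al in [set: seq nat]) ((twoN al)%:R ^+ k * cabs (x al))%:E :> \bar R)%E.
  by apply: esum_ge0 => al _; rewrite lee_fin mulr_ge0 ?exprn_ge0 ?cabs_ge0.
suff: forall k, (\max_(i <- s) sval i <= k)%N -> ((sf_max (P := S1_norms R) s x)%:E
   <= \esum_(al in [set: seq nat]) ((twoN al)%:R ^+ k * cabs (x al))%:E)%E by apply.
move=> k; elim: s => [|i s IH]; first by move=> _; rewrite /sf_max big_nil E0.
rewrite /sf_max !big_cons -/(sf_max _ _) geq_max => /andP[ik sk].
by rewrite EFin_max ge_max IH// S1_norm_le_esum.
Qed.

Lemma S1_is_nuclear : nuclear_space (S1 R).
Proof.
split; first exact: S1_hausdorff.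
move=> p pP pc.
have [s [C C0 pC]] := continuous_seminorm_le pP pc.
have [k sk] := S1_seq_bound s.
pose a al : R := C * (twoN al)%:R ^+ k.
have a0 al : 0 <= a al by rewrite mulr_ge0 ?exprn_ge0// ltW.
apply: (@coordinates_nuclear R (seq nat) (S1 R) (fun x => S1_val x) eS1 _ _ a inv_sqr_twoN) => //.
- exact: inv_sqr_twoN_gt0.
- exact: inv_sqr_twoN_summable.
- move=> x; apply: (@le_trans _ _ (C * sf_max (P := S1_norms R) s x)%:E).
    by rewrite lee_fin; exact: pC.
  rewrite EFinM; under eq_esum do rewrite /a -mulrA EFinM.
  rewrite esumZl; [|exact: ltW|]; last first.
    by move=> al; rewrite lee_fin mulr_ge0 ?exprn_ge0 ?cabs_ge0.
  by rewrite lee_pmul2l// sk.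
(* The norm of index 2 (k + 2) controls (2N)^((k + 2) al) |x_al|, and two of these
   powers are spent on the summable factor. *)
have k2 : (0 < (k + 2).*2)%N by rewrite addn2.
pose i : {p : nat | (0 < p)%N} := exist _ (k + 2).*2 k2.
have qP : is_seminorm (fun x => C * S1_norm i x).
  by apply: seminormZ; [exact: ltW|exact: S1_norm_seminorm].
exists (fun x => C * S1_norm i x); split => //.
  by apply: (@seminorm_continuous _ _ (S1_norms R) _ i C qP (ltW C0)) => x.
move=> x al; rewrite /a mulrCA -mulrA ler_pM2l//.
rewrite inv_sqr_twoNE ler_pdivlMl; last by rewrite exprn_gt0// ltr0n twoN_gt0.
by rewrite mulrA -exprD addnC twoN_coord_le.
Qed.

End S1_nuclear.

Section Sm1_nuclear.
Context {R : realType}.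
Local Notation bset := {B : set (S1 R) | tvs_bounded B}.

(** This is the condition on b for the multiples b_al e_al to form a bounded subset
    of S1. *)
Definition rapid (b : seq nat -> R) :=
  forall k : nat, exists M : R, forall al, b al * (twoN al)%:R ^+ k <= M.

Lemma rapidD (b c : seq nat -> R) : rapid b -> rapid c -> rapid (b \+ c).
Proof.
move=> hb hc k; have [M bM] := hb k; have [N cN] := hc k.
by exists (M + N) => al /=; rewrite mulrDl lerD.
Qed.

Lemma rapidZ (C : R) (b : seq nat -> R) : 0 <= C -> rapid b ->
  rapid (fun al => C * b al).
Proof.
move=> C0 hb k; have [M bM] := hb k.
by exists (C * M) => al; rewrite -mulrA ler_wpM2l.
Qed.

Lemma rapid_twoN (b : seq nat -> R) (l : nat) : rapid b ->
  rapid (fun al => b al * (twoN al)%:R ^+ l).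
Proof.
move=> hb k; have [M bM] := hb (l + k)%N.
by exists M => al; rewrite -mulrA -exprD.
Qed.

Lemma rapid_bounded (b : seq nat -> R) : (forall al, 0 <= b al) -> rapid b ->
  tvs_bounded (range (fun al => (b al)%:C *: eS1 al) : set (S1 R)).
Proof.
move=> b0 hb U [s [e e0 sU]].
have [M [M0 bM]] : exists M : R, 0 <= M /\ forall al,
    sf_max (P := S1_norms R) s ((b al)%:C *: eS1 al) <= M.
  elim: s {sU} => [|i s [M [M0 IH]]].
    by exists 0; split => // al; rewrite /sf_max big_nil.
  have [N bN] := hb (sval i).
  exists (Num.max M N); split; first by rewrite le_max M0.
  move=> al; rewrite /sf_max big_cons -/(sf_max _ _) ge_max !le_max IH /= andbT.
  apply/orP; right; apply: le_trans (bN al).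
  rewrite (_ : S1_norm i _ = cabs (b al)%:C * S1_norm i (eS1 al)); last first.
    exact: (sf_valP i).2.
  rewrite cabs_real ger0_norm// ler_wpM2l//.
  rewrite -lee_fin (le_trans (S1_norm_le_esum _ (leqnn _)))//.
  rewrite (esum_single (i := al)).
  - by rewrite /= /delta eqxx cabs_delta mulr1.
  - by rewrite lee_fin mulr_ge0 ?exprn_ge0 ?cabs_ge0.
  - by move=> j ja; rewrite /= /delta (negbTE ja) cabs_delta mulr0.
(* M + 1 instead of M: the scaling factor has to be positive, and the ball of
   radius e is open. *)
have r0 : 0 < (M + 1) / e by rewrite divr_gt0// ltr_wpDl.
exists ((M + 1) / e) => // _ [al _ <-].
set x : S1 R := _ *: _.
exists ((((M + 1) / e)^-1)%:C *: x); last first.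
  by rewrite scalerA -complexRM divff ?gt_eqF// scale1r.
apply: sU; rewrite /mkset subr0 sf_maxZ cabs_real gtr0_norm ?invr_gt0//.
rewrite ltr_pdivrMl// mulrC mulrC divfK ?gt_eqF//.
by rewrite (le_lt_trans (bM al))// ltrDl.
Qed.

Definition coord_sup (B : set (S1 R)) (al : seq nat) : R :=
  sup [set cabs (S1_val x al) | x in B].

Lemma coord_bound (B : set (S1 R)) (k : nat) : tvs_bounded B ->
  exists M, forall x al, B x -> (twoN al)%:R ^+ k * cabs (S1_val x al) <= M.
Proof.
(* k.+1 because the norms of S1 have positive indices. *)
move=> Bb; have k0 : (0 < k.+1.*2)%N by [].
have [M BM] := S1_norm_bounded (exist _ k.+1.*2 k0) Bb.
exists M => x al Bx; apply: le_trans (BM _ Bx).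
apply: le_trans (twoN_coord_le x al k0).
by rewrite ler_wpM2r ?cabs_ge0// ler_weXn2l ?twoN_ge1.
Qed.

Lemma coord_sup_ub (B : set (S1 R)) x al : tvs_bounded B -> B x ->
  cabs (S1_val x al) <= coord_sup B al.
Proof.
move=> Bb Bx; apply: ub_le_sup; last by exists x.
have [M BM] := coord_bound 0 Bb; exists M => _ [y By <-].
by have := BM y al By; rewrite expr0 mul1r.
Qed.

Lemma coord_sup_ge0 (B : set (S1 R)) al : tvs_bounded B -> 0 <= coord_sup B al.
Proof.
move=> Bb; have [B0|/set0P[x Bx]] := eqVneq B set0.
  by rewrite /coord_sup B0 image_set0 sup0.
exact: le_trans (cabs_ge0 _) (coord_sup_ub al Bb Bx).
Qed.

Lemma coord_sup_rapid (B : set (S1 R)) : tvs_bounded B -> rapid (coord_sup B).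
Proof.
move=> Bb k; have [M BM] := coord_bound k Bb; exists (Num.max M 0) => al.
have t0 : 0 < (twoN al)%:R ^+ k :> R by rewrite exprn_gt0// ltr0n twoN_gt0.
rewrite -ler_pdivlMr//.
have [B0|/set0P[x Bx]] := eqVneq B set0.
  by rewrite /coord_sup B0 image_set0 sup0 divr_ge0 ?(ltW t0)// le_max lexx orbT.
apply: ge_sup; first by exists (cabs (S1_val x al)), x.
by move=> _ [y By <-]; rewrite ler_pdivlMr// mulrC le_max BM.
Qed.

Lemma dual_seminorm_le_esum (B : bset) (f : Sm1_space R) :
  ((dual_seminorm B f)%:E
   <= \esum_(al in [set: seq nat]) (coord_sup (sval B) al * cabs (f al))%:E)%E.
Proof.
set X := esum _ _.
have Bb := svalP B.
have X0 : (0 <= X)%E.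
  by apply: esum_ge0 => al _; rewrite lee_fin mulr_ge0 ?cabs_ge0 ?coord_sup_ge0.
have [Xoo|] := eqVneq X +oo%E; first by rewrite Xoo leey.
rewrite -ltey => Xfin.
have XE : X = (fine X)%:E by rewrite fineK// ge0_fin_numE.
rewrite XE lee_fin /dual_seminorm.
have [B0|/set0P[x0 Bx0]] := eqVneq (sval B) set0.
  by rewrite B0 image_set0 sup0 fine_ge0.
apply: ge_sup; first by exists (cabs (pairing f x0)), x0.
move=> _ [x Bx <-]; rewrite -lee_fin -XE.
apply: (le_trans (cabs_csum (pairing_summable f x))).
apply: le_esum => al _; rewrite lee_fin cabsM mulrC ler_wpM2r ?cabs_ge0//.
exact: coord_sup_ub.
Qed.

(** Adding the coordinatewise suprema of the bounded sets in s controls the maximum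
    of their dual seminorms, and preserves rapid decrease. *)
Lemma dual_seq_bound (s : seq bset) : exists a : seq nat -> R,
  [/\ forall al, 0 <= a al, rapid a &
   forall f : Sm1_space R, ((sf_max (P := dual_seminorms R) s f)%:E
   <= \esum_(al in [set: seq nat]) (a al * cabs (f al))%:E)%E].
Proof.
elim: s => [|B s [a [a0 ar af]]].
  exists (fun=> 0); split => // [k|f].
    by exists 0 => al; rewrite mul0r.
  by rewrite /sf_max big_nil esum_ge0// => al _; rewrite mul0r.
have Bb := svalP B.
exists (coord_sup (sval B) \+ a); split => [al||f].
- by rewrite addr_ge0// coord_sup_ge0.
- by apply: rapidD => //; exact: coord_sup_rapid.
rewrite /sf_max big_cons -/(sf_max _ _) EFin_max ge_max; apply/andP; split.
  apply: (le_trans (dual_seminorm_le_esum B f)); apply: le_esum => al _.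
  by rewrite lee_fin ler_wpM2r ?cabs_ge0// lerDl.
apply: (le_trans (af f)); apply: le_esum => al _.
by rewrite lee_fin ler_wpM2r ?cabs_ge0// lerDr coord_sup_ge0.
Qed.

Lemma pairing_eS1 (f : Sm1_space R) (c : R) al :
  pairing f (c%:C *: eS1 al) = c%:C * f al.
Proof.
have E be : S1_val (c%:C *: eS1 al) be = c%:C * delta al be by [].
rewrite /pairing (csum_single (i := al)) => [|be ba].
  by rewrite E /delta eqxx mulr1 mulrC.
by rewrite E /delta (negbTE ba) !mulr0.
Qed.

Definition rapid_set (b : seq nat -> R) (b0 : forall al, 0 <= b al)
    (br : rapid b) : bset := exist _ _ (rapid_bounded b0 br).

Lemma dual_rapid_ge (b : seq nat -> R) (b0 : forall al, 0 <= b al)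
    (br : rapid b) (f : Sm1_space R) al :
  b al * cabs (f al) <= dual_seminorm (rapid_set b0 br) f.
Proof.
apply: ub_le_sup; first exact: dual_has_ubound.
exists ((b al)%:C *: eS1 al); first by exists al.
by rewrite pairing_eS1 cabsM cabs_real ger0_norm.
Qed.

Lemma Sm1_hausdorff : hausdorff_space (Sm1 R).
Proof.
apply: lctvs_hausdorff => f f0.
have [al fal] : exists al, f al != 0.
  apply: contrapT => h; move/eqP: f0; apply; apply: val_inj; apply/funext => al.
  by apply/eqP; apply: contrapT => /negP fal; apply: h; exists al.
pose b be : R := (be == al)%:R.
have b0 be : 0 <= b be by rewrite ler0n.
have br : rapid b.
  move=> k; exists ((twoN al)%:R ^+ k) => be; rewrite /b.
  by case: eqP => [->|_]; rewrite ?mul1r// mul0r exprn_ge0.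
exists (rapid_set b0 br); apply: lt_le_trans (dual_rapid_ge b0 br f al).
rewrite /b eqxx mul1r lt_neqAle cabs_ge0 andbT eq_sym.
by apply: contra fal => /eqP/cabs_eq0 ->.
Qed.

Lemma delta_Sm1 (al : seq nat) : delta al \in Sm1_pred (R := R).
Proof. by apply/asboolP; exists 1%N => //; exact: delta_l2. Qed.

Definition eSm1 (al : seq nat) : Sm1_space R := Sm1Space (delta_Sm1 al).

(** The seminorm q is the dual seminorm of the bounded set of all b_al e_al with
    b_al = a_al (2N)^(2 al), because <f, b_al e_al> = b_al f_al. *)
Lemma Sm1_is_nuclear : nuclear_space (Sm1 R).
Proof.
split; first exact: Sm1_hausdorff.
move=> p pP pc.
have [s [C C0 pC]] := continuous_seminorm_le pP pc.
have [a' [a'0 a'r sa']] := dual_seq_bound s.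
pose a al : R := C * a' al.
have a0 al : 0 <= a al by rewrite mulr_ge0// ltW.
apply: (@coordinates_nuclear R (seq nat) (Sm1 R) (fun f => Sm1_val f) eSm1 _ _ a inv_sqr_twoN) => //.
- exact: inv_sqr_twoN_gt0.
- exact: inv_sqr_twoN_summable.
- move=> f; apply: (@le_trans _ _ (C * sf_max (P := dual_seminorms R) s f)%:E).
    by rewrite lee_fin; exact: pC.
  rewrite EFinM; under eq_esum do rewrite /a -mulrA EFinM.
  rewrite esumZl; [|exact: ltW|]; last first.
    by move=> al; rewrite lee_fin mulr_ge0 ?cabs_ge0.
  by rewrite lee_pmul2l// sa'.
pose b al : R := a al * (twoN al)%:R ^+ 2.
have b0 al : 0 <= b al by rewrite mulr_ge0 ?exprn_ge0.
have br : rapid b by apply: rapid_twoN; apply: rapidZ => //; exact: ltW.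
have qP := dual_seminormP (rapid_set b0 br).
exists (dual_seminorm (rapid_set b0 br)); split => //.
  apply: (@seminorm_continuous _ _ (dual_seminorms R) _ (rapid_set b0 br) 1 qP ler01).
  by move=> f; rewrite mul1r.
move=> f al; rewrite inv_sqr_twoNE ler_pdivlMl; last by rewrite exprn_gt0// ltr0n twoN_gt0.
by rewrite mulrA [X in X * _]mulrC dual_rapid_ge.
Qed.

End Sm1_nuclear.

Theorem theorem4p1 (R : realType) :
  (* (a) *)
  (nuclear_space (S1 R) /\ nuclear_space (Sm1 R)) /\
  (* (b) *)
  (forall p q : int, p + 2 <= q ->
    (Bconst R q p ^+ 2)%E =
      \esum_(al in [set: seq nat]) ((twoN al)%:R ^ (- (q - p)) : R)%:E /\
    \esum_(al in [set: seq nat]) ((twoN al)%:R ^ (- (q - p)) : R)%:E =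
      (1 / (1 - 2 ^ (- (q - p)) * zeta ((q - p)%:~R : R)))%:E) /\
  (* (c) *)
  (forall p q : int, p + 2 <= q ->
    forall (f : fock R (- p)) (g : fock R (- q)),
    (fock_norm q (wick f g) <= Bconst R q p * fock_norm p f * fock_norm q g)%E /\
    (fock_norm q (wick g f) <= Bconst R q p * fock_norm p f * fock_norm q g)%E).
Proof.
have le2 (p q : int) : p + 2 <= q -> p <= q /\ 2 <= q - p.
  by move=> h; rewrite lerBrDl h (le_trans _ h)// lerDl.
split; first by split; [exact: S1_is_nuclear|exact: Sm1_is_nuclear].
split=> [p q /le2[pq s2]|p q /le2[pq s2] f g].
  by split; [exact: Bconst_sqr|exact: twoN_sum].
have B0 : (0 <= Bconst R q p)%E by exact: poweR_ge0.
have BS := Bconst_sqr (R := R) pq; have SE := twoN_sum (R := R) s2.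
by split; apply: norm_le_of_sqnorm B0 BS _; rewrite SE;
  [exact: wick_sqnorm_le|exact: wick_sqnorm_le_sym].
Qed.
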